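(* For every $n\ge 1$, the maximum probability $p_n=\sup_{\tau\in\mathcal{M}_n}P(R_\tau=1)$ of selecting one of the two best applicants is $$p_n=\frac{1}{3n}\left\{\left(1-r_n+\sum_{i=1}^{r_n-1}\prod_{j=i}^{r_n-1}\frac{2(n-j)}{2(n-j)+1}\right)\left(3-\sum_{\ell=r_n}^{n-1}\frac{1}{\ell}\right)+2n+r_n\right\},$$ and $$\lim_{n\to\infty}p_n=r+\frac{4}{3r}\left[(1-r)^{3/2}-(1-r)^2\right]=0.767974\ldots,$$ where $r=\lim_{n\to\infty}r_n/n$.
   Context: Fix an integer $n\ge1$. There are $2n$ applicants with absolute ranks $1,1,2,2,\ldots,n,n$ (1 is best, $n$ is worst), interviewed in a uniformly random order: $R_j$ denotes the absolute rank of the $j$-th applicant, $j=1,\ldots,2n$, and $P\bigl((R_1,\ldots,R_{2n})=\sigma\bigr)=2^n/(2n)!$ for every distinct arrangement $\sigma$ of the multiset $(1,1,2,2,\ldots,n,n)$. For $1\le j\le 2n$: - $X_j$ is the number of distinct values in $\{R_i:\ R_i\le R_j,\ 1\le i\le j\}$ (the relative rank of the $j$-th applicant among the first $j$). - $D_j$ is the number of distinct values in $\{R_1,\ldots,R_j\}$. $\mathcal{F}_j$ is the $\sigma$-algebra generated by $(X_1,D_1),\ldots,(X_j,D_j)$, and $\mathcal{M}_n$ is the set of all stopping rules (stopping times) with values in $\{1,\ldots,2n\}$ adapted to the filtration $\{\mathcal{F}_j\}_{1\le j\le 2n}$. For $i=1,\ldots,n$ let $$\alpha(i)=\frac{2n}{i}+\sum_{j=i+1}^{n}\frac{1}{j-1},$$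 and let $r_n=\min\{\,i\ge 1:\ \alpha(i)\le 5\,\}$. Empty sums are $0$. The limit $r:=\lim_{n\to\infty}r_n/n$ exists and is the number $r>0$ (approximately $0.470927$) satisfying $re^{-2/r}=e^{-5}$. *)

(* Defs.v *)
From HB Require Import structures.
From mathcomp Require Import all_boot all_order all_algebra.
From mathcomp Require Import all_classical all_reals all_analysis.

Set Implicit Arguments.
Unset Strict Implicit.
Unset Printing Implicit Defensive.

Import Order.TTheory GRing.Theory Num.Theory.
Import numFieldNormedType.Exports.

Local Open Scope classical_set_scope.
Local Open Scope ring_scope.

(* Conventions: ranks are the natural numbers 1, ..., n (1 is best, each used
   twice). The 2n applicants are indexed by 'I_n.*2, so that the j-th applicant
   (j = 1, ..., 2n) is the ordinal of value j - 1. *)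

Section outcome.
Variables (n : nat) (a : 'I_n.*2 -> nat).

Definition rel_rank (j : 'I_n.*2) : nat :=
  size (undup [seq a i | i : 'I_n.*2 <- enum 'I_n.*2
                       & (i <= j)%N && (a i <= a j)%N]).

Definition distinct_ranks (j : 'I_n.*2) : nat :=
  size (undup [seq a i | i : 'I_n.*2 <- enum 'I_n.*2 & (i <= j)%N]).

End outcome.

Section interview.
Context {d : measure_display} {T : measurableType d} {R : realType}.
Variables (P : probability T R) (n : nat) (rk : 'I_n.*2 -> {RV P >-> nat}).

Definition uniform_order : Prop :=
  forall s : n.*2.-tuple nat, perm_eq s (iota 1 n ++ iota 1 n) ->
    P [set w | [tuple rk j w | j < n.*2] = s]
    = ((2 ^ n)%:R / (n.*2)`!%:R)%:E.

Definition observation (j : 'I_n.*2) (w : T) : nat * nat :=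
  (rel_rank (fun i => rk i w) j, distinct_ranks (fun i => rk i w) j).

Definition observed_sigma (j : 'I_n.*2) : set (set T) :=
  <<s \bigcup_(i in [set i : 'I_n.*2 | (i <= j)%N])
        preimage_set_system setT (observation i) measurable >>.

Definition stopping_rules : set (T -> 'I_n.*2) :=
  [set tau | forall j, observed_sigma j [set w | tau w = j]].

Definition max_success : \bar R :=
  ereal_sup [set P [set w | rk (tau w) w = 1%N] | tau in stopping_rules].

End interview.

Section threshold.
Variable R : realType.

Definition alpha (n i : nat) : R :=
  n.*2%:R / i%:R + \sum_(i.+1 <= j < n.+1) (j.-1%:R)^-1.

(* The default value n of the minimum is harmless, since alpha n n = 2 <= 5 for
   n >= 1; see rthreshP. *)
Definition rthresh (n : nat) : nat :=
  \big[minn/n]_(1 <= i < n.+1 | alpha n i <= 5) i.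

Lemma rthreshP (n : nat) : (1 <= n)%N ->
  [/\ (1 <= rthresh n <= n)%N, alpha n (rthresh n) <= 5
    & forall i, (1 <= i <= n)%N -> alpha n i <= 5 -> (rthresh n <= i)%N].
Proof.
move=> n1; have an : alpha n n <= 5.
  rewrite /alpha big_geq // addr0 -muln2 natrM mulrAC divff ?pnatr_eq0 -?lt0n//.
  by rewrite mul1r ler_nat.
have [rP ra] : (1 <= rthresh n <= n)%N /\ alpha n (rthresh n) <= 5.
  rewrite /rthresh big_seq_cond.
  apply: (big_ind (fun x => (1 <= x <= n)%N /\ alpha n x <= 5)).
  - by rewrite n1 leqnn.
  - by move=> x y Px Py; rewrite /minn; case: ifP.
  - by move=> i /andP[]; rewrite mem_index_iota ltnS.
split=> // i i1n ai; rewrite /rthresh.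
have : i \in index_iota 1 n.+1 by rewrite mem_index_iota ltnS.
elim: (index_iota _ _) => // x s IH; rewrite inE big_cons => /orP[/eqP <-|/IH].
  by rewrite ai geq_minl.
by case: ifP => // _ le; rewrite geq_min le orbT.
Qed.

End threshold.

(* Main.v *)
Require Import Defs.
From HB Require Import structures.
From mathcomp Require Import all_boot all_order all_algebra.
From mathcomp Require Import all_classical all_reals all_analysis.
From mathcomp Require Import zify ring lra.

Set Implicit Arguments.
Unset Strict Implicit.
Unset Printing Implicit Defensive.

Import Order.TTheory GRing.Theory Num.Theory.
Import numFieldNormedType.Exports.

Local Open Scope classical_set_scope.
Local Open Scope ring_scope.

(** The successive observations [(X_i, D_i)], [i <= j], carry exactly the
    relative order of the first [j] ranks, ties included, i.e. a word of length
    [j] using each value [1, ..., k] once or twice.  Given such a word all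
    completions are equally likely whatever the word, the best rank seen so far
    is [1] with probability [k / n], and the next observation is a Markov step
    in (k, multiplicity of the best rank).  It never pays to select the first
    copy of a best rank: if that rank is [1], its second copy will come.  Hence
    only two value functions are needed, [A k] (best rank seen once) and [B k]
    (seen twice), with

      (2 (n - k) + 1) A_k = max (k / n) B_k + 2 (n - k) A_{k+1},
      (k + 1) B_k = A_{k+1} + k B_{k+1},   A_n = 1,   B_n = 0,

    and the optimal value is [A 1].  For [k >= r_n] one finds
    [A k = (k + 2 n) / (3 n)], and [B k <= k / n] amounts to [alpha k <= 5];
    below [r_n] the ratio [(B_k - A_k) / k] is geometric with factors
    [2 (n - k) / (2 (n - k) + 1)].

    For the limit, the sum of products telescopes to
    [2 n u - 2 (n - r_n + 1)] where [u] is the product starting at [1], and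
    [u ^ 2] lies between [1 - r_n / n] and [1 - r_n / n + 1 / n]. *)

(** * Standardised words *)

Local Open Scope nat_scope.

Lemma undup_map_in (T1 T2 : eqType) (f : T1 -> T2) (s : seq T1) :
  {in s &, injective f} -> undup (map f s) = map f (undup s).
Proof.
elim: s => //= x s IH injf.
rewrite IH; last by move=> y z ys zs; apply: injf; rewrite inE ?ys ?zs orbT.
suff -> : (f x \in map f s) = (x \in s) by case: ifP.
apply/mapP/idP => [[y ys fxy]|xs]; last by exists x.
by rewrite (injf x y) // inE ?eqxx ?ys ?orbT.
Qed.

Definition relrk (p : seq nat) (x : nat) : nat :=
  size (undup [seq y <- p | y <= x]).

(** Canonical representative of an order pattern with ties: two words have the same [std] exactly
    when their entries compare alike, position by position. *)
Definition std (p : seq nat) : seq nat := map (relrk p) p.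

Lemma leq_mono_in_inj (f : nat -> nat) (p : seq nat) :
  {in p &, {mono f : x y / x <= y}} -> {in p &, injective f}.
Proof.
move=> fm x y xp yp fxy; apply/eqP.
by rewrite eqn_leq -(fm x y) // -(fm y x) // fxy leqnn.
Qed.

Lemma relrk_map (f : nat -> nat) p x :
  {in p &, {mono f : x y / x <= y}} -> x \in p ->
  relrk (map f p) (f x) = relrk p x.
Proof.
move=> fm xp; rewrite /relrk filter_map.
rewrite undup_map_in ?size_map; last first.
  move=> y z; rewrite !mem_filter => /andP[_ yp] /andP[_ zp].
  exact: (leq_mono_in_inj fm).
by congr (size (undup _)); apply: eq_in_filter => y yp /=; rewrite fm.
Qed.

Lemma std_map (f : nat -> nat) p :
  {in p &, {mono f : x y / x <= y}} -> std (map f p) = std p.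
Proof.
move=> fm; rewrite /std -map_comp.
by apply/eq_in_map => x xp /=; rewrite relrk_map.
Qed.

Lemma relrk_le p : {homo relrk p : x y / x <= y}.
Proof.
move=> x y xy; apply: uniq_leq_size; first exact: undup_uniq.
move=> z; rewrite !mem_undup !mem_filter => /andP[zx ->].
by rewrite (leq_trans zx xy).
Qed.

Lemma relrk_lt p x y : x < y -> y \in p -> relrk p x < relrk p y.
Proof.
move=> xy yp; rewrite /relrk -[_.+1]/(size (y :: _)); apply: uniq_leq_size.
  by rewrite /= undup_uniq mem_undup mem_filter leqNgt xy.
move=> z; rewrite inE !mem_undup !mem_filter => /orP[/eqP->|/andP[zx ->]].
  by rewrite leqnn.
by rewrite (leq_trans zx (ltnW xy)).
Qed.

Lemma relrk_mono p : {in p &, {mono relrk p : x y / x <= y}}.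
Proof.
move=> x y xp yp; case: (leqP x y) => [xy|yx]; first by rewrite relrk_le.
by apply/negbTE; rewrite -ltnNge relrk_lt.
Qed.

(** Standardising preserves all comparisons, so a prefix of [std p] has the pattern of the same
    prefix of [p]. Hence the pattern of a word determines those of its prefixes. *)
Lemma std_take_std j p : std (take j (std p)) = std (take j p).
Proof.
rewrite /std -map_take -/(std _) std_map // => x y xp yp.
by rewrite relrk_mono // (mem_take xp, mem_take yp).
Qed.

Lemma size_undup_std p : size (undup (std p)) = size (undup p).
Proof.
rewrite undup_map_in ?size_map //; apply: leq_mono_in_inj; exact: relrk_mono.
Qed.

Lemma count_std p x : x \in p ->
  count_mem (relrk p x) (std p) = count_mem x p.
Proof.
move=> xp; rewrite count_map; apply: eq_in_count => y yp /=.
by rewrite (inj_in_eq (leq_mono_in_inj (@relrk_mono p))).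
Qed.

Lemma size_undup_rcons (p : seq nat) x :
  size (undup (rcons p x)) = size (undup p) + (x \notin p).
Proof.
rewrite undup_rcons size_rcons size_filter -(mem_undup p) addnC.
rewrite -(count_predC (pred1 x) (undup p)) count_uniq_mem ?undup_uniq //.
by case: (x \in _); rewrite ?addn0 ?add0n.
Qed.

Lemma relrk_rcons p x y :
  relrk (rcons p x) y = relrk p y + ((x <= y) && (x \notin p)).
Proof.
rewrite /relrk filter_rcons; case: (leqP x y) => xy /=; last by rewrite addn0.
by rewrite size_undup_rcons mem_filter xy.
Qed.

Lemma std_rcons_old p x : x \in p ->
  std (rcons p x) = rcons (std p) (relrk p x).
Proof.
move=> xp; rewrite /std map_rcons relrk_rcons xp andbF addn0; congr rcons.
by apply/eq_in_map => y yp; rewrite relrk_rcons xp andbF addn0.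
Qed.

Lemma relrk_lt_notin p x y : x \notin p -> y \in p ->
  (relrk p x < relrk p y) = (x <= y).
Proof.
move=> xp yp; case: (ltngtP x y) => [xy|yx|xy].
- exact: relrk_lt.
- by rewrite ltnNge relrk_le // ltnW.
- by rewrite xy yp in xp.
Qed.

(** A new value is inserted just above the [relrk p x] smaller ones, and [bump] shifts the larger
    ones up to make room. *)
Lemma std_rcons_new p x : x \notin p ->
  std (rcons p x) = rcons (map (bump (relrk p x).+1) (std p)) (relrk p x).+1.
Proof.
move=> xp; rewrite /std map_rcons relrk_rcons xp leqnn addn1; congr rcons.
rewrite -map_comp; apply/eq_in_map => y yp.
by rewrite relrk_rcons xp andbT addnC /= /bump relrk_lt_notin.
Qed.

(** The fixed points of [std]: no value between 1 and [k] is skipped. *)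
Definition packed k (w : seq nat) := w =i iota 1 k.

Lemma packed_size k w : packed k w -> size (undup w) = k.
Proof.
move=> /perm_undup/perm_size ->.
by rewrite undup_id ?iota_uniq // size_iota.
Qed.

Lemma std_packed k w : packed k w -> std w = w.
Proof.
move=> wk; rewrite -[RHS]map_id; apply/eq_in_map => x; rewrite wk => xk.
have: [seq y <- w | y <= x] =i iota 1 x.
  move=> y; rewrite mem_filter wk; move: xk; rewrite !mem_iota; lia.
exact: packed_size.
Qed.

Lemma packed_rcons_old k w z : packed k w -> z \in w -> packed k (rcons w z).
Proof.
by move=> wk zw x; rewrite mem_rcons inE -wk; case: eqP => // ->; rewrite zw.
Qed.

Lemma packed_rcons_new k w z : packed k w -> 1 <= z <= k.+1 ->
  packed k.+1 (rcons (map (bump z) w) z).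
Proof.
move=> wk zk x; rewrite mem_rcons inE mem_iota; case: eqVneq => [-> //|xz] /=.
apply/mapP/idP => [[y]|xk].
  by rewrite wk mem_iota => yk ->; move: zk yk; rewrite /bump; lia.
exists (unbump z x); last by rewrite unbumpK.
by rewrite wk mem_iota; move: xk zk xz; rewrite /unbump; lia.
Qed.

Lemma relrk_max p x : relrk p x <= size (undup p).
Proof.
apply: uniq_leq_size; first exact: undup_uniq.
by move=> z; rewrite !mem_undup mem_filter => /andP[].
Qed.

(** One-step extensions of a pattern: the first list adds the second copy of a rank seen once, the
    second inserts a new rank into one of the [k + 1] gaps. *)
Definition children (n k : nat) (w : seq nat) : seq (seq nat) :=
  [seq rcons w z | z <- iota 1 k & count_mem z w == 1]
  ++ (if k < n then [seq rcons (map (bump z) w) z | z <- iota 1 k.+1]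
      else [::]).

Lemma children_uniq n k w : packed k w -> uniq (children n k w).
Proof.
move=> wk; rewrite cat_uniq; apply/and3P; split.
- by rewrite map_inj_uniq ?filter_uniq ?iota_uniq // => x y /rcons_inj[].
(* The two lists are disjoint: [bump z] never takes the value [z], so a freshly inserted rank occurs
   once, whereas a repeated one occurs twice. *)
- case: ifP => // _; apply/hasPn => _ /mapP[z zk ->]; apply/mapP => -[y].
  rewrite mem_filter -wk => /andP[_ yw] /rcons_inj[ew ey].
  move: yw; rewrite -ew -ey => /mapP[x _ /eqP].
  by rewrite (negbTE (neq_bump _ _)).
- by case: ifP => // _; rewrite map_inj_uniq ?iota_uniq // => x y /rcons_inj[].
Qed.

Lemma std_bump z w : std (map (bump z) w) = std w.
Proof. by apply: std_map => x y _ _; rewrite leq_bump2. Qed.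

Definition orders n := permutations (iota 1 n ++ iota 1 n).

Lemma orders_packed n s : s \in orders n -> packed n s.
Proof.
by rewrite mem_permutations => /perm_mem sn x; rewrite sn mem_cat orbb.
Qed.

Lemma orders_size n s : s \in orders n -> size s = n.*2.
Proof.
by rewrite mem_permutations => /perm_size ->; rewrite size_cat size_iota addnn.
Qed.

Lemma orders_count n s x : s \in orders n -> count_mem x s = (0 < x <= n).*2.
Proof.
rewrite mem_permutations => /seq.permP ->.
rewrite count_cat addnn count_uniq_mem ?iota_uniq // mem_iota.
by rewrite add1n ltnS.
Qed.

(** This makes the children of [w] partition the orders lying above [w]. Forward, deleting the last
    letter gives back [w]. Backward, the next rank is either old, hence seen once so far since no
    rank occurs three times, or new, hence [k < n]. *)
Lemma children_mem n k w s : packed k w -> s \in orders n -> size w < n.*2 ->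
  (std (take (size w).+1 s) \in children n k w) = (std (take (size w) s) == w).
Proof.
move=> wk sn; rewrite -(orders_size sn) => jn.
set j := size w; apply/idP/eqP => [|sw].
  rewrite -(take_takel s (leqnSn j)) -(std_take_std j (take j.+1 s)).
  rewrite mem_cat => /orP[/mapP[z _ ->]|].
    by rewrite -cats1 take_size_cat // (std_packed wk).
  case: ifP => // _ /mapP[z _ ->].
  by rewrite -cats1 take_size_cat ?size_map // std_bump (std_packed wk).
rewrite (take_nth 0) //; set p := take j s; set x := nth 0 s j.
have kp : size (undup p) = k by rewrite -size_undup_std sw (packed_size wk).
have xs : x \in s by rewrite mem_nth.
rewrite mem_cat; case: (boolP (x \in p)) => xp.
  apply/orP; left; rewrite std_rcons_old // sw map_f // mem_filter -wk -sw.
  rewrite map_f // andbT count_std //.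
  have : count_mem x (rcons p x) <= count_mem x s.
    rewrite -[X in _ <= count_mem _ X](cat_take_drop j.+1 s).
    by rewrite (take_nth 0) // count_cat leq_addr.
  rewrite (orders_count _ sn) -cats1 count_cat /= eqxx.
  move: xp; rewrite -has_pred1 has_count; case: (0 < x <= n) => /=; lia.
apply/orP; right; rewrite std_rcons_new // sw -/j.
have -> : k < n.
  have : size (undup (rcons p x)) <= size (iota 1 n).
    apply: uniq_leq_size; first exact: undup_uniq.
    move=> y; rewrite mem_undup mem_rcons inE -(orders_packed sn).
    by case/orP => [/eqP->//|/mem_take].
  by rewrite size_undup_rcons xp kp addn1 size_iota.
apply/mapP; exists (relrk p x).+1 => //.
by have := relrk_max p x; rewrite kp mem_iota add1n ltnS.
Qed.

Lemma size_children n k w v : v \in children n k w -> size v = (size w).+1.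
Proof.
rewrite mem_cat => /orP[/mapP[z _ ->]|]; first by rewrite size_rcons.
by case: ifP => // _ /mapP[z _ ->]; rewrite size_rcons size_map.
Qed.

Local Open Scope ring_scope.

(** * The tree of relative orders *)

(** The patterns that occur as prefix patterns of some order in [orders n]. *)
Definition node n k (w : seq nat) :=
  [/\ packed k w, forall x, (count_mem x w <= 2)%N & (k <= n)%N].

Lemma packed_count_gt0 k w z : packed k w -> z \in iota 1 k ->
  (0 < count_mem z w)%N.
Proof. by move=> wk; rewrite -wk -has_pred1 has_count. Qed.

Lemma packed_sum_count k w : packed k w ->
  (\sum_(z <- iota 1 k) count_mem z w)%N = size w.
Proof.
move=> wk; rewrite -sum1_size.
under eq_bigr do rewrite -sum1_count.
rewrite (exchange_big_dep xpredT) //= [LHS]big_seq [RHS]big_seq.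
apply: eq_bigr => y; rewrite wk => yk; rewrite sum1_count.
rewrite (@eq_count _ _ (pred1 y)) => [|x /=]; last by rewrite eq_sym.
by rewrite count_uniq_mem ?iota_uniq // yk.
Qed.

(** Each of the [k] values contributes 2, either by two occurrences or by one occurrence and its
    flag as a single. This counts the children that repeat an old rank. *)
Lemma node_singles n k w : node n k w ->
  (count (fun z => count_mem z w == 1%N) (iota 1 k) + size w = 2 * k)%N.
Proof.
move=> [wk w2 _]; rewrite -(packed_sum_count wk) -sum1_count big_mkcond /=.
rewrite -big_split /= big_seq (eq_bigr (fun=> 2%N)) => [|z zk].
  by rewrite -big_seq big_const_seq count_predT size_iota iter_addn addn0.
by have := packed_count_gt0 wk zk; have := w2 z; case: (count_mem z w) => [|[|[]]].
Qed.

Lemma node_full n k w : node n k w -> size w = n.*2 -> w \in orders n.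
Proof.
move=> wN wn; have := node_singles wN; have [wk w2 kn] := wN; rewrite wn => sk.
have kE : k = n by lia.
rewrite mem_permutations; apply/allP => x _ /=; apply/eqP.
rewrite count_cat addnn (count_uniq_mem _ (iota_uniq _ _)) -kE.
have : ~~ has (fun z => count_mem z w == 1%N) (iota 1 k).
  by rewrite has_count -leqNgt; lia.
move=> /hasPn/(_ x); case: (boolP (x \in _)) => xk.
  move=> /(_ isT); have := packed_count_gt0 wk xk; have := w2 x.
  by case: (count_mem x w) => [|[|[]]].
by move=> _; apply/count_memPn; rewrite wk.
Qed.

Lemma children_node n k w v : node n k w -> v \in children n k w ->
  node n (size (undup v)) v.
Proof.
move=> [wk w2 kn]; rewrite mem_cat => /orP[/mapP[z]|].
  rewrite mem_filter -wk => /andP[/eqP z1 zw] ->.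
  have vk := packed_rcons_old wk zw; rewrite (packed_size vk); split=> // x.
  rewrite -cats1 count_cat /= addn0; case: eqVneq => [<-|_]; first by rewrite z1.
  by rewrite addn0.
case: ifP => // kn' /mapP[z]; rewrite mem_iota add1n ltnS => zk ->.
have vk := packed_rcons_new wk zk; rewrite (packed_size vk); split=> // x.
rewrite -cats1 count_cat /= addn0 count_map; case: eqVneq => [<-|zx] /=.
  rewrite (eq_count (a2 := pred0)) ?count_pred0 // => y /=.
  by rewrite eq_sym (negbTE (neq_bump _ _)).
rewrite addn0 (leq_trans _ (w2 (unbump z x))) // sub_count // => y /= /eqP <-.
by rewrite bumpK.
Qed.

(** All orders being equally likely, this is an unnormalised conditional expectation of [f] given
    the prefix pattern [w]. *)
Definition fiber (R : realFieldType) n (w : seq nat) (f : seq nat -> R) : R :=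
  \sum_(s <- orders n | std (take (size w) s) == w) f s.

Lemma fiber_children (R : realFieldType) n k w (f : seq nat -> R) :
  packed k w -> (size w < n.*2)%N ->
  fiber n w f = \sum_(v <- children n k w) fiber n v f.
Proof.
move=> wk wn; rewrite /fiber.
rewrite [RHS]big_seq.
under [RHS]eq_bigr => v vw do rewrite (size_children vw) big_mkcond.
rewrite -big_seq exchange_big /= big_mkcond [LHS]big_seq [RHS]big_seq.
apply: eq_bigr => s sn; rewrite -(children_mem wk sn wn).
case: ifPn => sc.
  rewrite (bigD1_seq _ sc) ?(children_uniq _ wk) //= eqxx big1 ?addr0 // => v.
  by rewrite eq_sym => /negbTE ->.
rewrite big1_seq // => v /= vc; case: eqP => // sv.
by rewrite sv vc in sc.
Qed.

Lemma fiber_full (R : realFieldType) n k w (f : seq nat -> R) :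
  node n k w -> size w = n.*2 -> fiber n w f = f w.
Proof.
move=> wN wn; have wo := node_full wN wn.
rewrite /fiber wn big_seq_cond (eq_bigl (pred1 w)) => [|s /=].
  by rewrite -big_filter filter_pred1_uniq ?permutations_uniq // big_seq1.
case: (eqVneq s w) => [->|sw]; last first.
  apply/negP => /andP[sn]; apply/negP; move: sw.
  rewrite -(orders_size sn) take_size (std_packed (orders_packed sn)) //.
by rewrite wo -wn take_size (std_packed (orders_packed wo)) eqxx.
Qed.

(** Induction on the number of missing letters: [fiber] is additive over children, so a candidate
    [F] need only be checked on full words and for one step. *)
Lemma fiber_rec (R : realFieldType) n j (f F : seq nat -> R) :
  (forall k w, node n k w -> size w = n.*2 -> F w = f w) ->
  (forall k w, node n k w -> (j <= size w < n.*2)%N ->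
     F w = \sum_(v <- children n k w) F v) ->
  forall k w, node n k w -> (j <= size w <= n.*2)%N -> fiber n w f = F w.
Proof.
move=> Ffull Frec k w wN /andP[jw wn].
move: {2}(n.*2 - size w)%N (erefl (n.*2 - size w)%N) => m.
elim: m k w wN jw wn => [|m IH] k w wN jw wn wm.
  have {}wm : size w = n.*2 by lia.
  by rewrite (fiber_full _ wN wm) (Ffull _ _ wN wm).
have {}wn : (size w < n.*2)%N by lia.
have [wk _ _] := wN; rewrite (fiber_children _ wk wn).
rewrite (Frec _ _ wN) ?jw // big_seq [RHS]big_seq.
apply: eq_bigr => v vw; apply: IH (children_node wN vw) _ _ _;
  rewrite (size_children vw); lia.
Qed.

(** The children fall into four kinds: second copy of the best rank ([a]), second copy of another
    rank ([b]), new best rank ([c]), other new rank ([d]). The correction [a - b] accounts for the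
    best rank when it is among the singles. *)
Lemma big_children (R : realFieldType) n k w (F : seq nat -> R) a b c d :
  node n k w ->
  ((0 < k)%N -> F (rcons w 1%N) = a) ->
  (forall z, (2 <= z <= k)%N -> F (rcons w z) = b) ->
  ((k < n)%N -> F (rcons (map (bump 1) w) 1%N) = c) ->
  (forall z, (k < n)%N -> (2 <= z <= k.+1)%N ->
     F (rcons (map (bump z) w) z) = d) ->
  \sum_(v <- children n k w) F v =
    (2 * k - size w)%:R * b + (count_mem 1%N w == 1%N)%:R * (a - b)
    + (k < n)%:R * (c + k%:R * d).
Proof.
move=> wN Fa Fb Fc Fd; rewrite big_cat big_map big_filter /=; congr (_ + _).
  have := node_singles wN => <-; rewrite addnK.
  case: k wN Fa Fb {Fc Fd} => [|k] wN Fa Fb /=.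
    rewrite big_nil mul0r add0r; case: eqP => [w1|_]; last by rewrite mul0r.
    by have [wk _ _] := wN; have := wk 1%N; rewrite -has_pred1 has_count w1.
  rewrite big_cons Fa //.
  have -> : \sum_(z <- iota 2 k | count_mem z w == 1%N) F (rcons w z) =
      (count (fun z => count_mem z w == 1%N) (iota 2 k))%:R * b.
    rewrite big_seq_cond (eq_bigr (fun=> b)) => [|z].
      by rewrite -big_seq_cond big_const_seq iter_addr addr0 mulr_natl.
    by rewrite mem_iota => /andP[zk _]; apply: Fb; lia.
  by rewrite natrD; case: ifP => _ /=; ring.
case: ifP => kn; last by rewrite big_nil mul0r.
rewrite big_cons Fc // big_map mul1r; congr (_ + _).
rewrite big_seq (eq_bigr (fun=> d)) => [|z].
  by rewrite -big_seq big_const_seq count_predT size_iota iter_addr addr0 mulr_natl.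
by rewrite mem_iota => zk; apply: Fd; lia.
Qed.

(* The number of orders compatible with a given sequence of [j] observations
   showing [k] distinct ranks; [2 ^ (n - k)] is avoided because of truncated
   subtraction. *)
Definition completions (R : realFieldType) (n j k : nat) : R :=
  2 ^+ k * 'C(n, k)%:R * (n.*2 - j)`!%:R / 2 ^+ n.

Lemma completionsS (R : realFieldType) n j k : (j < n.*2)%N ->
  completions R n j k = (n.*2 - j)%:R * completions R n j.+1 k.
Proof.
move=> jn; rewrite /completions -[in LHS](subnSK jn) factS natrM (subnSK jn).
by rewrite !mulrA; congr (_ * _); ring.
Qed.

Lemma completionsSS (R : realFieldType) n j k : (k <= n)%N ->
  k.+1%:R * completions R n j k.+1 = 2 * (n - k)%:R * completions R n j k.
Proof.
move=> kn; rewrite /completions exprS.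
have := mul_bin_left n k.
move=> /(congr1 (fun x => x%:R : R)); rewrite !natrM => E.
transitivity (2 * 2 ^+ k * (k.+1%:R * 'C(n, k.+1)%:R) * (n.*2 - j)`!%:R / 2 ^+ n : R).
  by ring.
by rewrite E; ring.
Qed.

Lemma completions0 (R : realFieldType) n : (0 < n)%N ->
  completions R n 0 0 = completions R n 1 1.
Proof.
move=> n0; have := completionsSS R 1 (leq0n n); rewrite mul1r subn0 => ->.
by rewrite completionsS ?double_gt0 // subn0 -muln2 natrM; ring.
Qed.

Lemma completions_full (R : realFieldType) n : completions R n n.*2 n = 1.
Proof.
by rewrite /completions subnn binn !mulr1 divff // expf_neq0 // pnatr_eq0.
Qed.

Lemma completions_ge0 (R : realFieldType) n j k : 0 <= completions R n j k.
Proof. by rewrite /completions !(mulr_ge0, invr_ge0, exprn_ge0). Qed.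

Lemma node_full_distinct n k w : node n k w -> size w = n.*2 -> k = n.
Proof. by move=> wN wn; have := node_singles wN; case: wN; lia. Qed.

Lemma undup_rcons_old k w z : packed k w -> (1 <= z <= k)%N ->
  size (undup (rcons w z)) = k.
Proof.
move=> wk zk; apply: packed_size; apply: packed_rcons_old => //.
by rewrite wk mem_iota; lia.
Qed.

Lemma undup_rcons_new k w z : packed k w -> (1 <= z <= k.+1)%N ->
  size (undup (rcons (map (bump z) w) z)) = k.+1.
Proof. by move=> wk zk; apply/packed_size/packed_rcons_new. Qed.

Lemma natr_singles (R : realFieldType) n k w : node n k w ->
  (2 * k - size w)%:R = 2 * k%:R - (size w)%:R :> R.
Proof.
by move=> wN; have := node_singles wN => E; rewrite natrB ?natrM //; lia.
Qed.

Lemma completions_rec (R : realFieldType) n j k : (j < n.*2)%N -> (k <= n)%N ->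
  (2 * (n - k)%:R) * completions R n j.+1 k =
  (k < n)%:R * (k.+1%:R * completions R n j.+1 k.+1).
Proof.
move=> jn; rewrite leq_eqVlt => /orP[/eqP ->|kn].
  by rewrite subnn ltnn mulr0 !mul0r.
by rewrite kn mul1r completionsSS // ltnW.
Qed.

(** The one-step identity reduces to [2 n - j = (2 k - j) + 2 (n - k)]: the remaining applicants are
    missing second copies or belong to unseen ranks. *)
Lemma fiber_count (R : realFieldType) n k w : node n k w ->
  (size w <= n.*2)%N -> fiber n w (fun=> 1) = completions R n (size w) k.
Proof.
move=> wN wn; pose F (w : seq nat) := completions R n (size w) (size (undup w)).
transitivity (F w); last by rewrite /F; case: wN => /packed_size ->.
apply: (@fiber_rec R n 0 _ F) wN wn => {}k {}w wN wn; have [wk _ kn] := wN.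
  by rewrite /F (packed_size wk) (node_full_distinct wN wn) wn completions_full.
have jn : (size w < n.*2)%N by [].
pose D := completions R n (size w).+1 k.
pose E := completions R n (size w).+1 k.+1.
rewrite (@big_children _ n k w F D D E E wN) /F ?size_rcons ?size_map.
- rewrite (natr_singles _ wN) (packed_size wk) completionsS //.
  have := completions_rec R jn kn; rewrite !natrB ?(ltnW jn) // -/D -/E => H.
  by rewrite -muln2 natrM -natr1 in H *; lra.
- by move=> k0; rewrite (undup_rcons_old wk).
- by move=> z zk; rewrite size_rcons (undup_rcons_old wk) //; lia.
- by move=> kn'; rewrite (undup_rcons_new wk).
- by move=> z kn' zk; rewrite size_rcons size_map (undup_rcons_new wk) //; lia.
Qed.

(** A letter other than 1 never becomes 1, and a letter 1 stays so unless a new best rank appears,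
    which contributes 0. The [k] other insertions carry [(k + 1) / n], and [completions_rec] turns
    them into the weight [2 (n - k)] with factor [k / n]. *)
Lemma fiber_first_rank (R : realFieldType) n i k w : node n k w ->
  (i < size w <= n.*2)%N ->
  fiber n w (fun s => (nth 0%N s i == 1%N)%:R) =
  (nth 0%N w i == 1%N)%:R * (k%:R / n%:R) * completions R n (size w) k.
Proof.
move=> wN wn; have n0 : (0 < n)%N by lia.
have nN0 : n%:R != 0 :> R by rewrite pnatr_eq0 -lt0n.
pose F (w : seq nat) := (nth 0%N w i == 1%N)%:R *
  ((size (undup w))%:R / n%:R) * completions R n (size w) (size (undup w)).
transitivity (F w); last by rewrite /F; case: wN => /packed_size ->.
apply: (@fiber_rec R n i.+1 _ F) wN wn => {}k {}w wN wn; have [wk _ kn] := wN.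
  rewrite /F (packed_size wk) (node_full_distinct wN wn) wn completions_full.
  by rewrite divff // !mulr1.
have [iw jn] : (i < size w)%N /\ (size w < n.*2)%N by lia.
have wi0 : (0 < nth 0%N w i)%N.
  by have := mem_nth 0%N iw; rewrite wk mem_iota => /andP[].
pose D := (nth 0%N w i == 1%N)%:R * (k%:R / n%:R) * completions R n (size w).+1 k.
pose E := (nth 0%N w i == 1%N)%:R * (k.+1%:R / n%:R)
          * completions R n (size w).+1 k.+1.
rewrite (@big_children _ n k w F D D 0 E wN) /F ?size_rcons ?size_map.
- rewrite (natr_singles _ wN) (packed_size wk) completionsS //.
  have := completions_rec R jn kn.
  move=> /(congr1 (fun x => (nth 0%N w i == 1%N)%:R * (k%:R / n%:R) * x)).
  rewrite !natrB ?(ltnW jn) // /D /E -muln2 natrM -natr1.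
  move: (_^-1) => x; lra.
- by move=> k0; rewrite (undup_rcons_old wk) // nth_rcons iw.
- by move=> z zk; rewrite size_rcons (undup_rcons_old wk) ?nth_rcons ?iw //; lia.
- move=> kn'; rewrite nth_rcons size_map iw (nth_map 0%N) // /bump wi0.
  by rewrite add1n eqSS eqn0Ngt wi0 !mul0r.
- move=> z kn' zk; rewrite size_rcons size_map (undup_rcons_new wk) //; last by lia.
  rewrite nth_rcons size_map iw (nth_map 0%N) // /D /bump.
  by congr (_%:R * _ * _); lia.
Qed.

(** * Dynamic programming *)

Lemma eq_fiber (R : realFieldType) n w (f g : seq nat -> R) :
  (forall s, s \in orders n -> std (take (size w) s) = w -> f s = g s) ->
  fiber n w f = fiber n w g.
Proof.
move=> fg; rewrite /fiber big_seq_cond [RHS]big_seq_cond.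
by apply: eq_bigr => s /andP[sn /eqP]; exact: fg.
Qed.

(* [A k] and [B k] are the conditional success probabilities, when k distinct
   ranks have appeared and the present applicant is declined, according to
   whether the best of them has been seen once or twice. *)
Record is_value (R : realFieldType) (n : nat) (A B : nat -> R) : Prop := IsValue {
  value_full1 : A n = 1;
  value_full2 : B n = 0;
  value_rec1 : forall k, (0 < k < n)%N ->
    (2 * (n - k)%:R + 1) * A k =
    Num.max (k%:R / n%:R) (B k) + 2 * (n - k)%:R * A k.+1;
  value_rec2 : forall k, (0 < k < n)%N ->
    k.+1%:R * B k = A k.+1 + k%:R * B k.+1 }.

Section dynamic_programming.
Variables (R : realFieldType) (n : nat) (A B : nat -> R).
Hypotheses (n0 : (0 < n)%N) (AB : is_value n A B).

Lemma value_ge0 k : (0 < k <= n)%N -> 0 <= A k /\ 0 <= B k.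
Proof.
move=> /andP[k0 kn]; move: {2}(n - k)%N (erefl (n - k)%N) => m.
elim: m k k0 kn => [|m IH] k k0 kn km.
  have -> : k = n by lia.
  by rewrite (value_full1 AB) (value_full2 AB).
have [|||Ak Bk] := IH k.+1; try lia.
have kn' : (0 < k < n)%N by lia.
split.
- have := value_rec1 AB kn'.
  have c0 : 0 < 2 * (n - k)%:R + 1 :> R by rewrite ltr_wpDl ?mulr_ge0.
  rewrite -(pmulr_rge0 _ c0) => ->.
  by rewrite addr_ge0 ?mulr_ge0 // le_max divr_ge0.
- have := value_rec2 AB kn'.
  have c0 : 0 < k.+1%:R :> R by rewrite ltr0n.
  by rewrite -(pmulr_rge0 _ c0) => ->; rewrite addr_ge0 ?mulr_ge0.
Qed.

(** The empty word gets [A 1]: declining the first applicant, which never loses anything, leaves one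
    rank seen once. *)
Definition cont_value (w : seq nat) : R :=
  if size w == 0%N then A 1 else
  if count_mem 1%N w == 1%N then A (size (undup w)) else B (size (undup w)).

(** The last applicant is the second copy of the best rank so far, as opposed to an applicant of
    rank two. *)
Definition second_best (w : seq nat) :=
  (last 0%N w == 1%N) && (count_mem 1%N w == 2%N).

(** Value while the last applicant is still available. A choice is offered only at a second copy of
    the best rank; [node_value_ge] shows that stopping elsewhere never gains. *)
Definition node_value (w : seq nat) : R :=
  if second_best w then
    Num.max ((size (undup w))%:R / n%:R) (B (size (undup w)))
  else cont_value w.

Let value w := completions R n (size w) (size (undup w)) * node_value w.

Lemma cont_value_rec k w : node n k w -> (size w < n.*2)%N ->
  completions R n (size w) k * cont_value w =
  \sum_(v <- children n k w) value v.
Proof.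
move=> wN jn; have [wk w2 kn] := wN.
pose D := completions R n (size w).+1 k.
pose E := completions R n (size w).+1 k.+1.
pose q b := if b then A k else B k.
pose q' b := if b then A k.+1 else B k.+1.
pose c1 := count_mem 1%N w == 1%N.
rewrite (@big_children _ n k w value
  (D * (if c1 then Num.max (k%:R / n%:R) (B k) else B k)) (D * q c1)
  (E * A k.+1) (E * q' c1) wN); first last.
- move=> z kn' zk; rewrite /value /node_value /second_best /cont_value.
  rewrite size_rcons last_rcons size_map (undup_rcons_new wk) //; last by lia.
  have -> : z == 1%N = false by lia.
  rewrite -cats1 count_cat /= addn0 count_map.
  have -> : z == 1%N = false by lia.
  rewrite addn0 (eq_count (a2 := pred1 1%N)) // => y /=; rewrite /bump; lia.
- move=> kn'; rewrite /value /node_value /second_best /cont_value.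
  rewrite size_rcons size_map (undup_rcons_new wk) //.
  rewrite -cats1 count_cat /= addn0 count_map (eq_in_count (a2 := pred0)).
    by rewrite count_pred0 andbF.
  by move=> y /=; rewrite wk mem_iota /bump; lia.
- move=> z zk; rewrite /value /node_value /second_best /cont_value.
  rewrite size_rcons last_rcons (undup_rcons_old wk) //; last by lia.
  have z1 : z == 1%N = false by lia.
  by rewrite z1 -cats1 count_cat /= addn0 z1 addn0.
- move=> k0; rewrite /value /node_value /second_best /cont_value.
  rewrite size_rcons last_rcons (undup_rcons_old wk) // -cats1 count_cat /= addn0 addn1.
  have := packed_count_gt0 wk (_ : 1%N \in iota 1 k).
  rewrite mem_iota add1n !ltnS k0 => /(_ isT).
  by rewrite /c1; have := w2 1%N; case: (count_mem 1%N w) => [|[|[]]].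
rewrite (natr_singles _ wN); case: (posnP k) => k0.
  have w0 : w = [::].
    case: (w) wk => // x s /(_ x); rewrite k0 inE eqxx //.
  rewrite /c1 w0 /= k0 n0 /cont_value /= completions0 // /E w0 k0 /=; ring.
have w0 : size w == 0%N = false.
  apply/negbTE; rewrite size_eq0; apply/eqP => w0; have := wk 1%N.
  by rewrite w0 mem_iota /= add1n ltnS k0.
rewrite /cont_value w0 (packed_size wk) -/c1 completionsS //.
rewrite natrB ?(ltnW jn) // -muln2 natrM.
have := completions_rec R jn kn; rewrite natrB // -/D -/E => H.
case: (ltnP k n) H => kn'; rewrite ?mul1r ?mul0r ?addr0 => H.
  have kn2 : (0 < k < n)%N by rewrite k0.
  have := value_rec1 AB kn2; have := value_rec2 AB kn2.
  rewrite natrB //; move: (Num.max _ _) => mx; rewrite -natr1 in H *.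
  move: H; rewrite /q /q'; move: D E (A k) (B k) (A k.+1) (B k.+1) => D E a b a' b'.
  (* The goal is bilinear in completion weights and values. Scaling the weight relation [H] by a
     value and the value recursion by a weight leaves a linear combination. *)
  case: c1 => /= H HB HA.
    have := congr1 (fun x => x * a') H; have := congr1 (fun x => x * D) HA; lra.
  have := congr1 (fun x => x * b) H; have := congr1 (fun x => x * E) HB; lra.
(* All ranks have appeared, so only second copies remain: the missing copy of rank 1 wins surely,
   and nothing can be won once it has passed. *)
have kE : k = n by lia.
rewrite /q kE (value_full1 AB) (value_full2 AB) divff ?pnatr_eq0 -?lt0n //.
rewrite max_l //; case: c1 => /=; ring.
Qed.

(** Winning at index [j] or later: if [tau] does not stop at [j], then [j] may be replaced by
    [j + 1], which is what the induction along the tree uses. *)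
Let win_from (tau : seq nat -> nat) j (s : seq nat) : R :=
  ((j <= tau s)%N && (nth 0%N s (tau s) == 1%N))%:R.

Lemma cont_value_ge0 k w : node n k w -> 0 <= cont_value w.
Proof.
rewrite /cont_value => -[wk _ kn]; case: ifP => [_|w0].
  by have [] := @value_ge0 1.
have k0 : (0 < k)%N.
  case: w w0 wk => // x s _ /(_ x); rewrite inE eqxx mem_iota /=; lia.
by rewrite (packed_size wk); have [] := @value_ge0 k; rewrite ?k0 //; case: ifP.
Qed.

(** While the best rank has been seen once, its second copy is still to come, so declining keeps at
    least the chance [k / n]. *)
Lemma value1_ge k : (0 < k <= n)%N -> k%:R / n%:R <= A k.
Proof.
move=> /andP[k0 kn]; move: {2}(n - k)%N (erefl (n - k)%N) => m.
have nN0 : n%:R != 0 :> R by rewrite pnatr_eq0 -lt0n.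
elim: m k k0 kn => [|m IH] k k0 kn km.
  have -> : k = n by lia.
  by rewrite (value_full1 AB) divff.
have Ak : k.+1%:R / n%:R <= A k.+1 by apply: IH; lia.
have kn' : (0 < k < n)%N by lia.
have := value_rec1 AB kn'.
have c0 : 0 <= 2 * (n - k)%:R :> R by rewrite mulr_ge0.
rewrite -(ler_pM2l (ltr_wpDl c0 (@ltr01 R))) => ->.
rewrite mulrDl mul1r addrC lerD // ?le_max ?lexx // ler_wpM2l //.
by rewrite (le_trans _ Ak) // ler_wpM2r ?invr_ge0 // ler_nat.
Qed.

Lemma node_value_ge k w : node n k w -> size w != 0%N ->
  (last 0%N w == 1%N)%:R * (k%:R / n%:R) <= node_value w
  /\ cont_value w <= node_value w.
Proof.
move=> wN w0; have [wk w2 kn] := wN.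
have k0 : (0 < k)%N.
  case: w w0 wk {wN w2} => // x s _ /(_ x); rewrite inE eqxx mem_iota /=; lia.
rewrite /node_value /second_best (packed_size wk); case: eqP => l1 /=; last first.
  by rewrite mul0r (cont_value_ge0 wN).
have cw : (0 < count_mem 1%N w)%N.
  by rewrite -has_count has_pred1 -l1; case: (w) w0 => //= x s _; exact: mem_last.
rewrite mul1r /cont_value (negbTE w0) (packed_size wk).
case: ifPn => [/eqP->|c2]; first by rewrite !le_max !lexx orbT.
have -> : count_mem 1%N w == 1%N.
  by move: cw c2 (w2 1%N); case: (count_mem 1%N w) => [|[|[]]].
by rewrite lexx value1_ge // k0.
Qed.

Lemma fiber_nil (f : seq nat -> R) : fiber n [::] f = \sum_(s <- orders n) f s.
Proof. by apply: eq_bigl => s; rewrite take0. Qed.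

(** Backward induction along the tree. If [tau] stops at index [size w] for one order above a child
    [v], adaptedness makes it stop there for all of them and [fiber_first_rank] gives the payoff;
    otherwise the induction hypothesis applies to [v]. Both are bounded by [node_value v]. *)
Lemma win_count_le (tau : seq nat -> nat) :
  (forall s, s \in orders n -> (tau s < n.*2)%N) ->
  (forall s s', s \in orders n -> s' \in orders n ->
     std (take (tau s).+1 s) = std (take (tau s).+1 s') -> tau s' = tau s) ->
  \sum_(s <- orders n) (nth 0%N s (tau s) == 1%N)%:R
  <= completions R n 0 0 * A 1%N.
Proof.
move=> tau_lt tau_adapted.
suff H k w : node n k w -> (size w <= n.*2)%N ->
    fiber n w (win_from tau (size w)) <= completions R n (size w) k * cont_value w.
  have N0 : node n 0 [::] by [].
  by have := H _ _ N0 (leq0n _); rewrite fiber_nil.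
move: {2}(n.*2 - size w)%N (erefl (n.*2 - size w)%N) => m.
elim: m k w => [|m IH] k w wm wN wn.
  have {}wm : size w = n.*2 by lia.
  rewrite (@eq_fiber _ _ _ _ (fun=> 0)) => [|s sn _].
    rewrite /fiber big1 // mulr_ge0 ?completions_ge0 ?(cont_value_ge0 wN) //.
  by rewrite /win_from wm leqNgt tau_lt.
have {}wn : (size w < n.*2)%N by lia.
have [wk _ kn] := wN.
rewrite (fiber_children _ wk wn) (cont_value_rec wN wn) big_seq [leRHS]big_seq.
apply: ler_sum => v vw; have vN := children_node wN vw.
have sv := size_children vw; set k' := size (undup v) in vN *.
have [|v1 v2] := node_value_ge vN; first by rewrite sv.
have [/hasP[s0 s0n /andP[/eqP s0v /eqP s0w]]|/hasPn nstop] :=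
  boolP (has (fun s => (std (take (size v) s) == v) && (tau s == size w)) (orders n)).
  rewrite (@eq_fiber _ _ _ _ (fun s => (nth 0%N s (size w) == 1%N)%:R)).
    have wv : (size w < size v <= n.*2)%N by rewrite sv leqnn.
    rewrite (fiber_first_rank _ vN wv) mulrC ler_wpM2l ?completions_ge0 //.
    by rewrite (_ : nth 0%N v (size w) = last 0%N v) // -nth_last sv.
  move=> s sn sv'; rewrite /win_from (tau_adapted s0 s) ?s0w ?leqnn //.
  by rewrite -sv s0v.
apply: (@le_trans _ _ (completions R n (size v) k' * cont_value v)); last first.
  by rewrite ler_wpM2l ?completions_ge0.
rewrite (@eq_fiber _ _ _ _ (win_from tau (size v))); last first.
  move=> s sn sv'; have := nstop s sn; rewrite sv' eqxx /= /win_from sv.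
  by rewrite (leq_eqVlt (size w)) eq_sym => /negbTE ->.
by apply: IH; rewrite ?sv //; lia.
Qed.

(** * Optimality of the threshold rule *)

Section threshold_rule.
Variable r : nat.
Hypotheses (r_le : (r <= n)%N)
  (stop_ge : forall k, (0 < k <= n)%N -> (r <= k)%N -> B k <= k%:R / n%:R)
  (stop_lt : forall k, (0 < k < r)%N -> k%:R / n%:R <= B k).

Definition stops (w : seq nat) := second_best w && (r <= size (undup w))%N.

(** The search covers all indices but the last, so that the default of [find] is the index of the
    last applicant, who is taken if nobody else was. *)
Definition threshold_rule (s : seq nat) : nat :=
  find (fun j => stops (std (take j.+1 s))) (iota 0 n.*2.-1).

Lemma threshold_rule_lt s : (threshold_rule s < n.*2)%N.
Proof.
rewrite (leq_ltn_trans (find_size _ _)) // size_iota prednK // double_gt0 //.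
Qed.

Lemma threshold_rule_stops s : (threshold_rule s < n.*2.-1)%N ->
  stops (std (take (threshold_rule s).+1 s)).
Proof.
move=> tn.
have : has (fun j => stops (std (take j.+1 s))) (iota 0 n.*2.-1).
  by rewrite has_find size_iota.
by move=> /(nth_find 0%N); rewrite nth_iota.
Qed.

Lemma threshold_rule_ge s j : (j < n.*2)%N ->
  (forall i, (i < j)%N -> ~~ stops (std (take i.+1 s))) ->
  (j <= threshold_rule s)%N.
Proof.
move=> jn js; rewrite leqNgt; apply/negP => tj; have /negP := js _ tj; apply.
by apply: threshold_rule_stops; lia.
Qed.

Lemma threshold_rule_le s j :
  stops (std (take j.+1 s)) -> (threshold_rule s <= j)%N.
Proof.
move=> js; rewrite leqNgt; apply/negP => jt; have := before_find 0%N jt.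
rewrite nth_iota ?add0n ?js // -ltnS prednK ?double_gt0 //.
by rewrite (leq_ltn_trans jt) ?threshold_rule_lt.
Qed.

Lemma threshold_rule_adapted s s' :
  (forall i, (i <= threshold_rule s)%N ->
     std (take i.+1 s) = std (take i.+1 s')) ->
  threshold_rule s' = threshold_rule s.
Proof.
move=> ss'; apply/eqP; rewrite eqn_leq; apply/andP; split.
  have [tn|tn] := ltnP (threshold_rule s) n.*2.-1.
    by apply: threshold_rule_le; rewrite -ss' // threshold_rule_stops.
  by have := threshold_rule_lt s'; lia.
apply: threshold_rule_ge; first exact: threshold_rule_lt.
move=> i it; rewrite -ss' ?(ltnW it) //; apply/negP => /threshold_rule_le.
by rewrite leqNgt it.
Qed.

(** The induction of [win_count_le] with equalities. It is restricted to nodes none of whose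
    prefixes triggers the rule, since only there is the rule still running. *)
Lemma win_count_threshold :
  \sum_(s <- orders n) (nth 0%N s (threshold_rule s) == 1%N)%:R
  = completions R n 0 0 * A 1%N.
Proof.
suff H k w : node n k w -> (size w <= n.*2)%N ->
    (forall s i, s \in orders n -> std (take (size w) s) = w -> (i < size w)%N ->
       ~~ stops (std (take i.+1 s))) ->
    fiber n w (win_from threshold_rule (size w))
    = completions R n (size w) k * cont_value w.
  have N0 : node n 0 [::] by [].
  by have := H _ _ N0 (leq0n _); rewrite fiber_nil; apply.
move: {2}(n.*2 - size w)%N (erefl (n.*2 - size w)%N) => m.
elim: m k w => [|m IH] k w wm wN wn nstop.
  have {}wm : size w = n.*2 by lia.
  rewrite (@eq_fiber _ _ _ _ (fun=> 0)) => [|s sn _]; last first.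
    by rewrite /win_from wm leqNgt threshold_rule_lt.
  rewrite /fiber big1 // /cont_value wm double_eq0 eqn0Ngt n0 /=.
  have [wk _ _] := wN; rewrite (packed_size wk) (node_full_distinct wN wm).
  rewrite (orders_count _ (node_full wN wm)) n0 /= (value_full2 AB) mulr0 //.
have {}wn : (size w < n.*2)%N by lia.
have [wk _ kn] := wN.
rewrite (fiber_children _ wk wn) (cont_value_rec wN wn) big_seq [RHS]big_seq.
apply: eq_bigr => v vw; have vN := children_node wN vw.
have sv := size_children vw.
have fvw s : s \in orders n -> std (take (size v) s) = v ->
    std (take (size w) s) = w.
  by move=> sn svs; apply/eqP; rewrite -(children_mem wk sn wn) -sv svs.
have nstopv s : s \in orders n -> std (take (size v) s) = v ->
    (size w <= threshold_rule s)%N.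
  move=> sn svs; apply: threshold_rule_ge => // i.
  by apply: nstop; rewrite ?(fvw s).
have [_ _ vn] := vN; have v0 : (0 < size (undup v))%N.
  by case: (v) sv => // x t _; rewrite -has_predT has_undup.
have [sp|sp] := boolP (stops v).
  rewrite (@eq_fiber _ _ _ _ (fun s => (nth 0%N s (size w) == 1%N)%:R)).
    have wv : (size w < size v <= n.*2)%N by rewrite sv leqnn.
    rewrite (fiber_first_rank _ vN wv) (_ : nth 0%N v (size w) = last 0%N v).
      have /andP[s2 rv] := sp; rewrite /value /node_value s2.
      rewrite max_l; last by rewrite stop_ge // v0.
      by have /andP[-> _] := s2; rewrite mul1r mulrC.
    by rewrite -nth_last sv.
  move=> s sn svs; rewrite /win_from (_ : threshold_rule s = size w) ?leqnn //.
  by apply/eqP; rewrite eqn_leq nstopv // threshold_rule_le // -sv svs.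
rewrite (@eq_fiber _ _ _ _ (win_from threshold_rule (size v))); last first.
  move=> s sn svs; rewrite /win_from sv nstopv //=.
  case: (ltngtP (size w) (threshold_rule s)) (nstopv s sn svs) => //= ts _.
  (* Only the default choice of the last applicant is possible here, and it must lose: an order
     ending in rank 1 satisfies [stops], because [r <= n]. *)
  have [tn|tn] := ltnP (size w) n.*2.-1.
    by move: sp; rewrite -svs sv ts threshold_rule_stops // -ts.
  have vn2 : size v = n.*2 by rewrite sv; lia.
  have vE : s = v.
    by rewrite -svs vn2 -(orders_size sn) take_size (std_packed (orders_packed sn)).
  move: sp; rewrite /stops /second_best (node_full_distinct vN vn2) r_le andbT.
  rewrite -vE (orders_count _ sn) n0 /= andbT -nth_last (orders_size sn) -vn2 sv.
  by rewrite -ts /= => /negbTE ->.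
rewrite (IH (size (undup v)) v) ?sv //; [|lia|].
  rewrite /value sv; congr (_ * _); rewrite /node_value; case: ifPn => // s2.
  move: sp; rewrite /stops s2 -ltnNge => rv.
  rewrite max_r ?stop_lt ?v0 // /cont_value sv /=.
  by have /andP[_ /eqP ->] := s2.
move=> s i sn svs; rewrite ltnS leq_eqVlt => /orP[/eqP ->|iw].
  by rewrite svs.
by apply: nstop; rewrite // (fvw s) // sv.
Qed.

End threshold_rule.

End dynamic_programming.

(** * The explicit value function *)

Lemma sum_by_parts (R : realFieldType) (g : nat -> R) r : (0 < r)%N ->
  \sum_(1 <= i < r) i%:R * (g i.+1 - g i) =
  (r%:R - 1) * g r - \sum_(1 <= i < r) g i.
Proof.
elim: r => // -[|r] IH _; first by rewrite !big_geq // subrr mul0r subr0.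
by rewrite big_nat_recr //= IH // [in RHS]big_nat_recr //= -natr1; ring.
Qed.

Section explicit_values.
Variables (R : realFieldType) (n r : nat).
Hypothesis r_range : (0 < r <= n)%N.

Definition harmonic_from (k : nat) : R := \sum_(k <= l < n) l%:R^-1.

Hypotheses
  (alpha_ge : forall k, (r <= k <= n)%N ->
     2 * n%:R / k%:R + harmonic_from k <= 5)
  (alpha_lt : forall k, (0 < k < r)%N ->
     5 < 2 * n%:R / k%:R + harmonic_from k).

Definition decline_prob (j : nat) : R :=
  2 * (n - j)%:R / (2 * (n - j)%:R + 1).

(* [value_gap k] is [(B k - A k) / k]: the advantage of having already seen
   both copies of the current best rank, which is geometric below [r] *)
Definition value_gap (k : nat) : R :=
  \prod_(k <= j < r) decline_prob j
  * ((harmonic_from (maxn k r) - 3) / (3 * n%:R)).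

(** Writing [B k = A k + k * g k], the recursion for [B] becomes
    [A k = A k.+1 + k * (g k.+1 - g k)], which is summed here from [k] up to [r]. From [r] on the
    sum is empty and [maxn k r] is [k]. *)
Definition value1 (k : nat) : R :=
  ((maxn k r)%:R + 2 * n%:R) / (3 * n%:R)
  + \sum_(k <= i < r) i%:R * (value_gap i.+1 - value_gap i).

Definition value2 (k : nat) : R := value1 k + k%:R * value_gap k.

Let n0 : (0 < n)%N. Proof. by case/andP: r_range; exact: leq_trans. Qed.
Let nN0 : n%:R != 0 :> R. Proof. by rewrite pnatr_eq0 -lt0n. Qed.

Lemma harmonic_fromS k : (k < n)%N ->
  harmonic_from k = k%:R^-1 + harmonic_from k.+1.
Proof. by move=> kn; rewrite /harmonic_from big_ltn. Qed.

Lemma value_gap_ge k : (r <= k)%N ->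
  value_gap k = (harmonic_from k - 3) / (3 * n%:R).
Proof. by move=> rk; rewrite /value_gap big_geq // mul1r (maxn_idPl rk). Qed.

Lemma value1_ge_r k : (r <= k)%N -> value1 k = (k%:R + 2 * n%:R) / (3 * n%:R).
Proof. by move=> rk; rewrite /value1 [X in _ + X]big_geq // addr0 (maxn_idPl rk). Qed.

Lemma value_gap_lt k : (k < r)%N ->
  (2 * (n - k)%:R + 1) * value_gap k = 2 * (n - k)%:R * value_gap k.+1.
Proof.
move=> kr; rewrite /value_gap big_ltn // (maxn_idPr (ltnW kr)) (maxn_idPr kr).
have c0 : 2 * (n - k)%:R + 1 != 0 :> R by rewrite gt_eqF // ltr_wpDl ?mulr_ge0.
by rewrite /decline_prob; field; rewrite nN0.
Qed.

Lemma value1_lt k : (k < r)%N ->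
  value1 k = value1 k.+1 + k%:R * (value_gap k.+1 - value_gap k).
Proof.
move=> kr; rewrite /value1 big_ltn // (maxn_idPr (ltnW kr)) (maxn_idPr kr); ring.
Qed.

Lemma value2_rec k : (0 < k < n)%N ->
  k.+1%:R * value2 k = value1 k.+1 + k%:R * value2 k.+1.
Proof.
move=> /andP[k0 kn]; rewrite /value2; case: (ltnP k r) => kr.
  by rewrite value1_lt // -natr1; ring.
rewrite !value1_ge_r ?(leqW kr) // !value_gap_ge ?(leqW kr) //.
rewrite harmonic_fromS // -natr1; field.
by rewrite nN0 pnatr_eq0 -lt0n k0.
Qed.

Lemma value2_le k : (r <= k <= n)%N -> value2 k <= k%:R / n%:R.
Proof.
move=> /andP[rk kn]; have := @alpha_ge k; rewrite rk kn => /(_ isT) ak.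
rewrite /value2 value1_ge_r // value_gap_ge //.
have k0 : 0 < k%:R :> R by rewrite ltr0n; case/andP: r_range; lia.
have nP : 0 < n%:R :> R by rewrite ltr0n.
move: ak; rewrite addrC -lerBrDr => H.
have {}H : harmonic_from k * k%:R <= 5 * k%:R - 2 * n%:R.
  have := ler_wpM2r (ltW k0) H; rewrite mulrBl divfK ?gt_eqF //.
rewrite ler_pdivlMr //.
rewrite [leLHS](_ : _ = (k%:R + 2 * n%:R + k%:R * (harmonic_from k - 3)) / 3).
  by lra.
by field.
Qed.

(** Descending induction from [r]. The hypothesis [alpha_lt] enters only at [k = r - 1]; further
    down, [value2_rec] makes [value2 k] a weighted mean of [value1 k.+1] and [value2 k.+1], both at
    least [(k + 1) / n]. *)
Lemma value_ge k : (0 < k <= r)%N ->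
  k%:R / n%:R <= value1 k /\ ((k < r)%N -> k%:R / n%:R <= value2 k).
Proof.
move=> /andP[k0 kr]; have /andP[_ rn] := r_range.
have nP : 0 < n%:R :> R by rewrite ltr0n.
have rn' : r%:R <= n%:R :> R by rewrite ler_nat.
move: {2}(r - k)%N (erefl (r - k)%N) => m.
elim: m k k0 kr => [|m IH] k k0 kr km.
  have -> : k = r by lia.
  split; last by rewrite ltnn.
  rewrite value1_ge_r // ler_pdivrMr //.
  by rewrite [leRHS](_ : _ = (r%:R + 2 * n%:R) / 3); [lra|field].
have kr' : (k < r)%N by lia.
have kP : 0 < k%:R :> R by rewrite ltr0n.
have [|||Ak Bk] := IH k.+1; try lia.
have B : k%:R / n%:R <= value2 k.
  case: (ltnP k.+1 r) => kr2.
    have {}Bk := Bk kr2.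
    have k1 : 0 < k.+1%:R :> R by rewrite ltr0n.
    rewrite -(ler_pM2l k1) value2_rec; last by rewrite k0; lia.
    have : k%:R / n%:R <= k.+1%:R / n%:R :> R.
      by rewrite ler_wpM2r ?invr_ge0 ?ler_nat // ltW.
    have : 0 <= k%:R / n%:R :> R by rewrite divr_ge0.
    have := ler_wpM2l (ltW kP) Bk; rewrite -natr1 in Ak *; lra.
  have kE : k.+1 = r by lia.
  have := @alpha_lt k; rewrite k0 kr' => /(_ isT).
  rewrite harmonic_fromS; last by lia.
  rewrite /value2 value1_lt // kE value1_ge_r // value_gap_ge // -kE -natr1.
  move=> /ltW; rewrite addrA -lerBlDr => H.
  have {}H : 5 * k%:R - harmonic_from k.+1 * k%:R <= 2 * n%:R + 1.
    have := ler_wpM2r (ltW kP) H; rewrite /= mulrBl (mulrDl _ k%:R^-1).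
    by rewrite mulfVK ?gt_eqF // mulVf ?gt_eqF //; lra.
  rewrite ler_pdivrMr //.
  rewrite [leRHS](_ : _ = (k%:R + 1 + 2 * n%:R + k%:R * (harmonic_from k.+1 - 3)) / 3).
    by lra.
  by field.
split=> //.
have c0 : 0 < 2 * (n - k)%:R + 1 :> R by rewrite ltr_wpDl ?mulr_ge0.
rewrite -(ler_pM2l c0) (value1_lt kr').
have gE := value_gap_lt kr'.
rewrite [leRHS](_ : _ = value2 k + 2 * (n - k)%:R * value1 k.+1); last first.
  rewrite /value2 (value1_lt kr'); move: gE; move: (value_gap k) (value_gap k.+1) => g g' gE.
  have := congr1 (fun x => x * k%:R) gE; lra.
rewrite mulrDl mul1r addrC lerD // ler_wpM2l ?mulr_ge0 //.
by rewrite (le_trans _ Ak) // ler_wpM2r ?invr_ge0 ?ler_nat // ltW.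
Qed.

Lemma explicit_is_value : is_value n value1 value2.
Proof.
have /andP[r0 rn] := r_range.
have A1 : value1 n = 1 by rewrite value1_ge_r //; field.
have Bn : value2 n = 0.
  by rewrite /value2 A1 value_gap_ge // /harmonic_from big_geq //; field.
split=> // [k /andP[k0 kn]|]; last exact: value2_rec.
case: (ltnP k r) => kr.
  have [|_ /(_ kr) Bk] := @value_ge k; first by rewrite k0 ltnW.
  rewrite max_r // /value2 (value1_lt kr).
  have := congr1 (fun x => x * k%:R) (value_gap_lt kr).
  move: (value_gap k) (value_gap k.+1) => g g'; lra.
rewrite max_l ?value2_le ?kr ?(ltnW kn) // !value1_ge_r // ?leqW // -natr1.
rewrite natrB ?(ltnW kn) //; field.
by [].
Qed.

Lemma value1_1 : value1 1%N =
  1 / (3 * n%:R) *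
  ((1 - r%:R + \sum_(1 <= i < r) \prod_(i <= j < r) decline_prob j)
   * (3 - harmonic_from r) + 2 * n%:R + r%:R).
Proof.
have /andP[r0 rn] := r_range.
rewrite /value1 (maxn_idPr r0) sum_by_parts // value_gap_ge //.
rewrite (eq_big_nat _ _ (F2 := fun i => \prod_(i <= j < r) decline_prob j *
   ((harmonic_from r - 3) / (3 * n%:R)))) => [|i /andP[_ ir]]; last first.
  by rewrite /value_gap (maxn_idPr (ltnW ir)).
rewrite -big_distrl /=; field.
by [].
Qed.

End explicit_values.

(** * Observations and sigma-algebras *)

Lemma sigma_algebra_bigcup_count (T : Type) (C : countType) (G : set (set T))
    (F : C -> set T) : sigma_algebra setT G ->
  (forall c, G (F c)) -> G (\bigcup_c F c).
Proof.
move=> [G0 _ GU] GF.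
have -> : \bigcup_c F c = \bigcup_k (if unpickle k is Some c then F c else set0).
  apply/seteqP; split=> [w [c _ Fw]|w [k _]].
    by exists (pickle c); rewrite ?pickleK.
  by case: (unpickle k) => // c Fw; exists c.
by apply: GU => k; case: (unpickle k).
Qed.

(** [A] is the union, over the countably many value vectors [c] attained on [A], of the finite
    intersections of the fibres of the [f i] over [c i]. *)
Lemma sigma_algebra_saturated (T : Type) (I : finType) (C : countType)
    (G : set (set T)) (f : I -> T -> C) (A : set T) : sigma_algebra setT G ->
  (forall i c, G (f i @^-1` [set c])) ->
  (forall w w', (forall i, f i w = f i w') -> A w -> A w') -> G A.
Proof.
move=> GG Gf Asat; have [G0 GC _] := GG.
pose hit (c : {ffun I -> C}) := exists2 w, A w & forall i, f i w = c i.
have -> : A = \bigcup_c (if pselect (hit c) then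
    setT `\` \bigcup_i (setT `\` f i @^-1` [set c i]) else set0).
  apply/seteqP; split=> [w Aw|w [c _]].
    exists [ffun i => f i w] => //; case: pselect => [h|nh].
      by split=> // -[i _ [_]] /=; rewrite ffunE.
    by case: nh; exists w => // i; rewrite ffunE.
  case: pselect => // -[w' Aw' w'c] [_ wc]; apply: (Asat w') => // i.
  by rewrite w'c; apply: contrapT => ne; apply: wc; exists i => //; split=> // /esym.
apply: sigma_algebra_bigcup_count => // c; case: pselect => // h.
apply: (GC); apply: (sigma_algebra_bigcup_count GG) => i; apply: (GC).
exact: Gf.
Qed.

(** The sets that do not separate [w] from [w'] form a sigma-algebra containing the generators. *)
Lemma generated_saturated d' (T : Type) (I : Type) (S : measurableType d') (D : set I)
    (f : I -> T -> S) (A : set T) w w' :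
  <<s \bigcup_(i in D) preimage_set_system setT (f i) measurable >> A ->
  (forall i, D i -> f i w = f i w') -> A w -> A w'.
Proof.
move=> GA fww'; suff : A w <-> A w' by case.
move: A GA; apply: smallest_sub => /=.
  split=> // [A [Aw Aw']|A Asat].
    by split=> -[_ nA]; split=> // ?; apply: nA; auto.
  by split=> -[k _ Ak]; exists k => //; apply/Asat.
by move=> _ [i Di] [B _ <-] /=; rewrite /setI /= (fww' _ Di).
Qed.

Lemma enum_prefix m (j : 'I_m) :
  [seq i : 'I_m <- enum 'I_m | (i <= j)%N] = take j.+1 (enum 'I_m).
Proof.
apply: (inj_map val_inj); rewrite map_take val_enum_ord take_iota.
rewrite -(filter_map _ (fun i => (i <= j)%N)) val_enum_ord.
rewrite (minn_idPl (ltn_ord j)).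
by rewrite (eq_filter (a2 := fun i => (i < 0 + j.+1)%N)) // filter_iota_ltn.
Qed.

Section word_of_ranks.
Variables (n : nat) (a : 'I_n.*2 -> nat).

Definition rank_word : seq nat := [seq a i | i <- enum 'I_n.*2].

Lemma size_rank_word : size rank_word = n.*2.
Proof. by rewrite size_map size_enum_ord. Qed.

Lemma nth_rank_word (j : 'I_n.*2) : nth 0%N rank_word j = a j.
Proof. by rewrite (nth_map j) ?size_enum_ord // nth_ord_enum. Qed.

Lemma distinct_ranks_word (j : 'I_n.*2) :
  distinct_ranks a j = size (undup (take j.+1 rank_word)).
Proof. by rewrite /distinct_ranks enum_prefix map_take. Qed.

Lemma rel_rank_word (j : 'I_n.*2) :
  rel_rank a j = relrk (take j.+1 rank_word) (nth 0%N rank_word j).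
Proof.
rewrite /rel_rank /relrk nth_rank_word -map_take -enum_prefix filter_map.
rewrite -filter_predI; congr (size (undup (map _ _))).
by apply: eq_filter => i /=; rewrite andbC.
Qed.

End word_of_ranks.

(** The relative rank alone cannot tell a tie from a new value; growth of the number of distinct
    values does. *)
Lemma std_rcons p x : std (rcons p x) =
  let X := relrk (rcons p x) x in
  if size (undup (rcons p x)) == size (undup p) then rcons (std p) X
  else rcons (map (bump X) (std p)) X.
Proof.
rewrite /= size_undup_rcons relrk_rcons leqnn /=; case: (boolP (x \in p)) => xp /=.
  by rewrite !addn0 eqxx std_rcons_old.
by rewrite -[X in _ == X]addn0 eqn_add2l /= addn1 std_rcons_new.
Qed.

(** Forward, [std_rcons] rebuilds the pattern one observation at a time. Backward, the relative rank
    is the last letter of the prefix pattern and the other observation is its number of distinct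
    letters. *)
Lemma observations_stdP n (a b : 'I_n.*2 -> nat) (j : 'I_n.*2) :
  (forall i : 'I_n.*2, (i <= j)%N ->
     (rel_rank a i, distinct_ranks a i) = (rel_rank b i, distinct_ranks b i))
  <-> std (take j.+1 (rank_word a)) = std (take j.+1 (rank_word b)).
Proof.
split=> [ab|ab i ij].
  suff H m : (m <= j.+1)%N ->
      std (take m (rank_word a)) = std (take m (rank_word b)) by exact: H.
  elim: m => [|m IH] mj; first by rewrite !take0.
  have mn : (m < n.*2)%N := leq_trans mj (ltn_ord j).
  have [] := ab (Ordinal mn) mj.
  rewrite !rel_rank_word !distinct_ranks_word /=.
  rewrite !(take_nth 0%N) ?size_rank_word // !std_rcons => -> ->.
  have {}IH := IH (ltnW mj).
  by rewrite IH -(size_undup_std (take m _)) IH size_undup_std.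
have {}ab : std (take i.+1 (rank_word a)) = std (take i.+1 (rank_word b)).
  rewrite -(@take_takel _ i.+1 j.+1) // -[in RHS](@take_takel _ i.+1 j.+1) //.
  by rewrite -std_take_std ab std_take_std.
rewrite !distinct_ranks_word -size_undup_std ab size_undup_std; congr pair.
have wE c : rel_rank c i = nth 0%N (std (take i.+1 (rank_word c))) i.
  rewrite (nth_map 0%N) ?size_take ?size_rank_word; last first.
    by case: ifP => // _; exact: ltn_ord.
  by rewrite nth_take // rel_rank_word.
by rewrite !wE ab.
Qed.

(** * Probability of events determined by the word of ranks *)

Section interview_probability.
Context {d : measure_display} {T : measurableType d} {R : realType}.
Variables (P : probability T R) (n : nat) (rk : 'I_n.*2 -> {RV P >-> nat}).
Hypotheses (n0 : (0 < n)%N) (Huniform : uniform_order rk).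

Let word (w : T) : seq nat := rank_word (fun i => rk i w).
Let weight : R := (2 ^ n)%:R / (n.*2)`!%:R.

Lemma word_eqP w w' : word w = word w' <-> forall i, rk i w = rk i w'.
Proof.
split=> [ww' i|ww']; last by apply: eq_map => i; exact: ww'.
by rewrite -(nth_rank_word (fun i => rk i w)) -(nth_rank_word (fun i => rk i w')) -/(word w) ww'.
Qed.

Lemma measurable_rank_fiber i c : measurable (rk i @^-1` [set c]).
Proof. by rewrite -[X in measurable X]setTI; exact: measurable_funPT. Qed.

Lemma measurable_word_saturated A :
  (forall w w', word w = word w' -> A w -> A w') -> measurable A.
Proof.
move=> Asat.
apply: (@sigma_algebra_saturated _ _ _ _ (fun i : 'I_n.*2 => rk i : T -> nat)).
- exact: sigma_algebra_measurable.
- exact: measurable_rank_fiber.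
- by move=> w w' ww'; apply: Asat; apply/word_eqP.
Qed.

Lemma word_prob s : s \in orders n -> P [set w | word w = s] = weight%:E.
Proof.
move=> sn; have ss : size s == n.*2 by rewrite (orders_size sn).
rewrite -(@Huniform (Tuple ss)) /=; last by rewrite -mem_permutations.
congr (P _); apply/seteqP; split=> w /= ws.
  by apply: val_inj => /=; rewrite -ws.
by rewrite -[s]/(val (Tuple ss)) -ws.
Qed.

Lemma weight_completions : weight * completions R n 0 0 = 1.
Proof.
rewrite /weight /completions bin0 expr0 subn0 !mul1r natrX; field.
by rewrite pnatr_eq0 -lt0n fact_gt0 expf_neq0.
Qed.

Lemma sum_orders1 : \sum_(s <- orders n) 1 = completions R n 0 0.
Proof.
by rewrite -fiber_nil (@fiber_count _ _ 0).
Qed.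

Lemma prob_word_in (g : seq nat -> bool) (r : seq (seq nat)) : uniq r ->
  {subset r <= orders n} ->
  P [set w | word w \in r /\ g (word w)]
  = (\sum_(s <- r) (g s)%:R * weight)%:E.
Proof.
elim: r => [_ _|s r IH /= /andP[sr ur] sub].
  rewrite big_nil (_ : [set w | _] = set0) ?measure0 //.
  by apply/seteqP; split=> w // -[].
have mS (Q : seq nat -> Prop) : measurable [set w | Q (word w)].
  by apply: measurable_word_saturated => w w' /= ->.
rewrite (_ : [set w | _] = [set w | word w = s /\ g (word w)] `|`
    [set w | word w \in r /\ g (word w)]); last first.
  apply/seteqP; split=> w /=.
    by rewrite inE => -[/orP[/eqP|]]; [left|right].
  by move=> [[ws gw]|[wr gw]]; rewrite inE ?ws ?wr ?eqxx ?orbT // -ws.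
rewrite measureU //; first last.
- apply/seteqP; split=> w //= -[[ws _] [wr _]].
  by rewrite -ws wr in sr.
- exact: (mS (fun x => x \in r /\ g x)).
- exact: (mS (fun x => x = s /\ g x)).
rewrite big_cons EFinD; congr (_ + _)%E; last first.
  by apply: IH => // x xr; apply: sub; rewrite inE xr orbT.
case: (boolP (g s)) => gs.
  rewrite mul1r -(word_prob (sub s (mem_head _ _))); congr (P _).
  by apply/seteqP; split=> w /= => [[]//|ws]; rewrite ws.
rewrite mul0r (_ : [set w | _] = set0) ?measure0 //.
by apply/seteqP; split=> w //= -[->]; rewrite (negbTE gs).
Qed.

(** Outcomes whose word is not an order are unconstrained; uniformity gives the orders total mass 1,
    so the part of [A] outside them is null. *)
Lemma prob_word (A : set T) (g : seq nat -> bool) : measurable A ->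
  (forall w, word w \in orders n -> A w <-> g (word w)) ->
  P A = (weight * \sum_(s <- orders n) (g s)%:R)%:E.
Proof.
move=> mA Ag; pose U := [set w | word w \in orders n].
have mU : measurable U.
  by apply: measurable_word_saturated => w w'; rewrite /U /= => ->.
have PU : P U = 1%E.
  have := @prob_word_in xpredT _ (permutations_uniq _) (fun x => id).
  rewrite -big_distrl /= sum_orders1 mulrC weight_completions => <-.
  by congr (P _); apply/seteqP; split=> w //= [].
have -> : P A = (P (A `\` U) + P (A `&` U))%E by exact: measureDI.
rewrite (_ : P (A `\` U) = 0%E).
  rewrite add0e mulr_sumr; under eq_bigr do rewrite mulrC.
  rewrite -prob_word_in ?permutations_uniq //; congr (P _).
  apply/seteqP; split=> w /= [].
    by move=> Aw Uw; split=> //; apply/Ag.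
  by move=> Uw gw; split=> //; apply/Ag.
apply/eqP; rewrite eq_le measure_ge0 andbT.
have <- : P (~` U) = 0%E by rewrite probability_setC // PU subee.
by apply: le_measure; rewrite ?inE //; [exact: measurableD|exact: measurableC].
Qed.

End interview_probability.

(** * From stopping rules to functions of words *)

Section optimal_stopping.
Context {d : measure_display} {T : measurableType d} {R : realType}.
Variables (P : probability T R) (n : nat) (rk : 'I_n.*2 -> {RV P >-> nat}).
Hypotheses (n0 : (0 < n)%N) (Huniform : uniform_order rk).

Let word (w : T) : seq nat := rank_word (fun i => rk i w).

Lemma observation_word (j : 'I_n.*2) w w' :
  (forall i : 'I_n.*2, (i <= j)%N -> observation rk i w = observation rk i w')
  <-> std (take j.+1 (word w)) = std (take j.+1 (word w')).
Proof. exact: observations_stdP. Qed.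

Lemma measurable_set1_natpair (c : nat * nat) : measurable [set c].
Proof.
rewrite (_ : [set c] = [set c.1] `*` [set c.2]); first exact: measurableX.
by apply/seteqP; split=> [_ ->|[x y] /= [-> ->]] //; case: c.
Qed.

Lemma observed_sigma_saturated (j : 'I_n.*2) A :
  (forall w w', std (take j.+1 (word w)) = std (take j.+1 (word w')) ->
     A w -> A w') ->
  observed_sigma rk j A.
Proof.
move=> Asat; pose f (i : 'I_n.*2) w :=
  if (i <= j)%N then observation rk i w else (0, 0)%N.
have GG : sigma_algebra setT (observed_sigma rk j) by exact: smallest_sigma_algebra.
have [G0 GC _] := GG.
apply: (sigma_algebra_saturated (f := f) GG) => [i c|w w' ww'].
  have [ij|/negbTE ij] := boolP (i <= j)%N.
    have -> : f i = observation rk i by apply/funext => w; rewrite /f ij.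
    apply: sub_sigma_algebra; exists i => //; exists [set c].
      exact: measurable_set1_natpair.
    by rewrite setTI.
  have -> : f i = cst (0, 0)%N by apply/funext => w; rewrite /f ij.
  by rewrite preimage_cst; case: ifP => // _; rewrite -[setT]setD0; apply: GC.
apply: Asat; apply/observation_word => i ij.
by have := ww' i; rewrite /f ij.
Qed.

Lemma stopping_rule_observed tau w w' : stopping_rules rk tau ->
  std (take (tau w).+1 (word w)) = std (take (tau w).+1 (word w')) ->
  tau w' = tau w.
Proof.
move=> /(_ (tau w)) st /observation_word ww'.
exact: (generated_saturated st ww').
Qed.

Lemma stopping_rule_word tau w w' : stopping_rules rk tau ->
  word w = word w' -> tau w' = tau w.
Proof. by move=> st ww'; apply: stopping_rule_observed st _; rewrite ww'. Qed.

(** Every order has positive probability, hence is realised by some outcome. *)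
Lemma ex_word s : s \in orders n -> exists w, word w = s.
Proof.
move=> sn; apply: contrapT => /forallNP ns; have := word_prob Huniform sn.
rewrite (_ : [set w | _] = set0); last by apply/seteqP; split=> w // /ns.
rewrite measure0 => /eqP; rewrite eqe eq_sym mulf_eq0 invr_eq0 !pnatr_eq0.
by rewrite expn_eq0 /= eqn0Ngt fact_gt0.
Qed.

Lemma success_prob (tau : T -> 'I_n.*2) (g : seq nat -> nat) :
  (forall w, word w \in orders n -> g (word w) = tau w) ->
  stopping_rules rk tau ->
  P [set w | rk (tau w) w = 1%N] =
  ((2 ^ n)%:R / (n.*2)`!%:R
   * \sum_(s <- orders n) (nth 0%N s (g s) == 1%N)%:R)%:E.
Proof.
move=> gt st.
apply: (prob_word Huniform (g := fun s => nth 0%N s (g s) == 1%N)).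
  apply: (measurable_word_saturated (rk := rk)) => w w' ww' /=.
  by rewrite (stopping_rule_word st ww') -(iffLR (word_eqP rk w w') ww').
by move=> w wn /=; rewrite gt // nth_rank_word; split=> [->|/eqP].
Qed.

Lemma max_success_value r (A B : nat -> R) : is_value n A B -> (r <= n)%N ->
  (forall k, (0 < k <= n)%N -> (r <= k)%N -> B k <= k%:R / n%:R) ->
  (forall k, (0 < k < r)%N -> k%:R / n%:R <= B k) ->
  max_success rk = (A 1%N)%:E.
Proof.
move=> AB rn Bge Blt; apply/eqP; rewrite eq_le; apply/andP; split.
  apply: ge_ereal_sup => _ [tau st <-].
  (* A stopping rule depends on an outcome only through its word, so evaluating it at a chosen
     representative makes it a function of words. *)
  pose rep s := get [set w | word w = s].
  have repP w : word (rep (word w)) = word w by exact: (@getI _ [set w' | word w' = word w] w).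
  rewrite (@success_prob _ (fun s => tau (rep s))) // => [|w wn]; last first.
    by congr nat_of_ord; apply: stopping_rule_word.
  have -> : A 1%N = (2 ^ n)%:R / (n.*2)`!%:R * (completions R n 0 0 * A 1%N).
    by rewrite mulrA weight_completions mul1r.
  rewrite lee_fin ler_wpM2l ?divr_ge0 //.
  apply: (win_count_le n0 AB) => [s sn|s s' sn s'n ss']; first exact: ltn_ord.
  congr nat_of_ord.
  have [w ws] := ex_word sn; have [w' ws'] := ex_word s'n; subst s s'.
  by apply: stopping_rule_observed => //; rewrite !repP.
pose tau w : 'I_n.*2 := Ordinal (threshold_rule_lt n0 r (word w)).
have st : stopping_rules rk tau.
  move=> j; apply: observed_sigma_saturated => w w' ww' /= tw.
  apply: val_inj => /=; rewrite -tw /= in ww' *.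
  apply: threshold_rule_adapted => // i it.
  rewrite -(@take_takel _ i.+1 (threshold_rule n r (word w)).+1) //.
  rewrite -[in RHS](@take_takel _ i.+1 (threshold_rule n r (word w)).+1) //.
  by rewrite -std_take_std ww' std_take_std.
apply: ereal_sup_ubound; exists tau => //.
rewrite (@success_prob _ (threshold_rule n r)) // (win_count_threshold n0 AB rn Bge Blt).
by rewrite mulrA weight_completions // mul1r.
Qed.

End optimal_stopping.

(** * The threshold and harmonic sums *)

Lemma alphaE (R : realType) n i : (0 < i)%N ->
  alpha R n i = 2 * n%:R / i%:R + harmonic_from R n i.
Proof.
move=> i0; rewrite /alpha /harmonic_from -muln2 natrM (mulrC n%:R).
by rewrite big_add1 /=.
Qed.

(** Extends [alpha <= 5] from the threshold to every later index. *)
Lemma alpha_nonincreasing (R : realType) n i j : (0 < i)%N -> (i <= j <= n)%N ->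
  alpha R n j <= alpha R n i.
Proof.
move=> i0 /andP[]; elim: j => [|j IH]; first by case: i i0.
rewrite leq_eqVlt => /orP[/eqP -> //|]; rewrite ltnS => ij jn.
apply: le_trans (IH ij (ltnW jn)).
have jP : (0 < j)%N := leq_trans i0 ij.
have j0 : 0 < j%:R :> R by rewrite ltr0n.
rewrite !alphaE // (@harmonic_fromS _ _ j) //.
rewrite addrA lerD2r (le_trans (y := 2 * n%:R / j%:R)) //; last first.
  by rewrite lerDl invr_ge0 ltW.
by rewrite ler_wpM2l ?mulr_ge0 // lef_pV2 ?posrE ?ltr0n // ler_nat.
Qed.

Lemma max_success_formula d (T : measurableType d) (R : realType)
    (P : probability T R) (n : nat) (rk : 'I_n.*2 -> {RV P >-> nat}) :
  (0 < n)%N -> uniform_order rk ->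
  max_success rk = (value1 R n (rthresh R n) 1)%:E.
Proof.
move=> n0 Hu; have [rP rle rmin] := rthreshP R n0.
set r := rthresh R n in rP rle rmin *; have /andP[r0 rn] := rP.
have age k : (r <= k <= n)%N -> 2 * n%:R / k%:R + harmonic_from R n k <= 5.
  move=> rk'; have /andP[rk1 _] := rk'.
  by rewrite -alphaE ?(leq_trans r0) // (le_trans _ rle) // alpha_nonincreasing.
have alt k : (0 < k < r)%N -> 5 < 2 * n%:R / k%:R + harmonic_from R n k.
  move=> /andP[k0 kr]; rewrite -alphaE // ltNge; apply/negP => /rmin.
  by rewrite k0 (leq_trans (ltnW kr) rn) => /(_ isT); rewrite leqNgt kr.
apply: (max_success_value n0 Hu (explicit_is_value rP age alt) rn).
- by move=> k /andP[_ kn] rk'; apply: (value2_le rP age); rewrite rk'.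
- move=> k /andP[k0 kr]; have [|_] := @value_ge _ _ _ rP alt k.
    by rewrite k0 ltnW.
  exact.
Qed.

(** Induction on [n] with [1 / (n + 1) <= ln (n + 1) - ln n <= 1 / n], where both sides are
    instances of [ln (1 + x) <= x]. *)
Lemma harmonic_from_ln (R : realType) n i : (0 < i <= n)%N ->
  ln n%:R - ln i%:R <= harmonic_from R n i
  <= ln n%:R - ln i%:R + i%:R^-1 - n%:R^-1.
Proof.
move=> /andP[i0]; elim: n => [|n IH]; first by case: i i0.
rewrite leq_eqVlt => /orP[/eqP <-|].
  by rewrite /harmonic_from big_geq // subrr add0r subrr lexx.
rewrite ltnS => inn; have /andP[lo hi] := IH inn.
have n0 : (0 < n)%N := leq_trans i0 inn.
have nP : 0 < n%:R :> R by rewrite ltr0n.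
have SP : 0 < n.+1%:R :> R by rewrite ltr0n.
have HS : harmonic_from R n.+1 i = harmonic_from R n i + n%:R^-1.
  by rewrite /harmonic_from big_nat_recr.
have up : ln n.+1%:R - ln n%:R <= n%:R^-1 :> R.
  rewrite -ln_div ?posrE // -natr1 mulrDl divff ?gt_eqF // mul1r.
  by rewrite le_ln1Dx // (lt_trans (ltrN10 R)) // invr_gt0.
have dn : n.+1%:R^-1 <= ln n.+1%:R - ln n%:R :> R.
  rewrite -lerN2 opprB -ln_div ?posrE //.
  have -> : n%:R / n.+1%:R = 1 + - n.+1%:R^-1 :> R.
    by rewrite -natr1 in SP *; field; rewrite gt_eqF.
  by rewrite le_ln1Dx // ltrN2 invf_lt1 // ltr1n.
move: lo hi up dn; rewrite HS; move: (ln n.+1%:R) (n.+1%:R^-1) (n%:R^-1).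
by move=> a b c lo hi up dn; apply/andP; split; lra.
Qed.

(** * The limiting equation *)

Definition exp_taylor (R : realType) m (x : R) : R := \sum_(k < m) x ^+ k / k`!%:R.

Lemma is_derive_exp_taylor (R : realType) m (x : R) :
  is_derive x 1 (fun y : R => exp_taylor m.+1 (- y)) (- exp_taylor m (- x)).
Proof.
elim: m => [|m IH].
  rewrite {2}/exp_taylor big_ord0 oppr0.
  rewrite (_ : (fun y => _) = cst 1); first exact: is_derive_cst.
  by apply/funext => y; rewrite /exp_taylor big_ord1 expr0 divr1.
rewrite (_ : (fun y => _) = (fun y => exp_taylor m.+1 (- y))
   + (fun y => (- y) ^+ m.+1 / (m.+1)`!%:R)); last first.
  by apply/funext => y; rewrite /exp_taylor [in LHS]big_ord_recr.
rewrite [exp_taylor m.+1 _]big_ord_recr /= opprD -/(exp_taylor m (- x)).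
apply: is_deriveD.
rewrite (_ : (fun y => _) = (m.+1`!%:R^-1 \*: (-%R ^+ m.+1))); last first.
  by apply/funext => y /=; rewrite fctE mulrC.
apply: is_derive_eq.
rewrite factS natrM /GRing.scale /=; field.
by rewrite ?nat1r ?natr1 !pnatr_eq0 -!lt0n fact_gt0.
Qed.

(** The signed remainder vanishes at 0 and its derivative is the signed remainder with one term
    less, so its sign propagates by the mean value theorem. *)
Lemma expRN_taylor (R : realType) m (x : R) : 0 <= x ->
  0 <= (-1) ^+ m * (expR (- x) - exp_taylor m (- x)).
Proof.
elim: m x => [|m IH] x x0.
  by rewrite /exp_taylor big_ord0 subr0 mul1r expR_ge0.
pose f y : R := (-1) ^+ m.+1 * (expR (- y) - exp_taylor m.+1 (- y)).
pose df y : R := (-1) ^+ m * (expR (- y) - exp_taylor m (- y)).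
have fdf (y : R) : is_derive y 1 f (df y).
  have -> : f = (-1) ^+ m.+1 \*: ((expR \o -%R) - (fun y => exp_taylor m.+1 (- y))).
    by apply/funext.
  have D1 : is_derive y 1 (expR \o -%R : R -> R) (- expR (- y)).
    by apply: is_derive_eq; rewrite mulrN1.
  have D2 := is_derive_exp_taylor m y.
  apply: is_derive_eq; rewrite /df /GRing.scale /= exprS; ring.
have f0 : f 0 = 0.
  rewrite /f oppr0 expR0 /exp_taylor big_ord_recl expr0 divr1.
  rewrite big1 ?addr0 ?subrr ?mulr0 // => i _.
  by rewrite exprS mul0r mul0r.
have [|c] := @MVT_segment R f df 0 x x0 (fun y _ => fdf y).
  by apply: derivable_within_continuous => y _; apply: ex_derive.
rewrite in_itv /= f0 !subr0 => /andP[c0 _]; rewrite -/(f x) => ->.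
by rewrite mulr_ge0 // IH.
Qed.

Lemma exp_taylor_bounds (R : realType) m (x : R) : 0 <= x ->
  exp_taylor m.*2 (- x) <= expR (- x) <= exp_taylor m.*2.+1 (- x).
Proof.
move=> x0; apply/andP; split.
  by have := expRN_taylor m.*2 x0; rewrite -muln2 exprM sqrr_sign mul1r subr_ge0.
have := expRN_taylor m.*2.+1 x0.
by rewrite exprS -muln2 exprM sqrr_sign mulr1 mulN1r opprB subr_ge0.
Qed.

Lemma root_bound_lo (R : realType) (a := 470 / 10 ^+ 3 + 926 / 10 ^+ 6 : R) :
  a <= expR (2 / a - 5).
Proof.
(* [5 - 2 / a] rounded up; eight terms of the exponential series suffice. *)
pose t : R := 753 / 10 ^+ 3 + 49 / 10 ^+ 6.
have a0 : 0 < a by rewrite /a; lra.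
have at_ : - t <= 2 / a - 5.
  by rewrite lerBrDr ler_pdivlMr // /t /a; lra.
have t0 : 0 <= t by rewrite /t; lra.
apply: le_trans (_ : expR (- t) <= _); last by rewrite ler_expR.
have /andP[lo _] := exp_taylor_bounds 4 t0; apply: le_trans lo.
by rewrite /exp_taylor !big_ord_recl big_ord0 /= /bump !leq0n !add1n !factS fact0 /a /t; lra.
Qed.

Lemma root_bound_hi (R : realType) (b := 470 / 10 ^+ 3 + 928 / 10 ^+ 6 : R) :
  expR (2 / b - 5) <= b.
Proof.
(* [5 - 2 / b] rounded down; nine terms of the series bound from above. *)
pose t : R := 753 / 10 ^+ 3 + 66 / 10 ^+ 6.
have b0 : 0 < b by rewrite /b; lra.
have bt : 2 / b - 5 <= - t.
  by rewrite lerBlDr ler_pdivrMr // /t /b; lra.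
have t0 : 0 <= t by rewrite /t; lra.
apply: (@le_trans _ _ (expR (- t))); first by rewrite ler_expR.
have /andP[_ hi] := exp_taylor_bounds 4 t0; apply: (le_trans hi).
by rewrite /exp_taylor !big_ord_recl big_ord0 /= /bump !leq0n !add1n !factS fact0 /b /t; lra.
Qed.

(** The equation is the logarithm of [r * expR (- 2 / r) = expR (- 5)]; the two preceding bounds
    bracket the value -5 of [ln x - 2 / x]. *)
Lemma threshold_root (R : realType) : exists2 r : R,
  470 / 10 ^+ 3 + 926 / 10 ^+ 6 <= r <= 470 / 10 ^+ 3 + 928 / 10 ^+ 6
  & ln r = 2 / r - 5.
Proof.
pose a : R := 470 / 10 ^+ 3 + 926 / 10 ^+ 6.
pose b : R := 470 / 10 ^+ 3 + 928 / 10 ^+ 6.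
have a0 : 0 < a by rewrite /a; lra.
have ab : a <= b by rewrite /a /b; lra.
have b0 : 0 < b := lt_le_trans a0 ab.
pose f x : R := ln x - 2 / x.
have fa : f a <= -5.
  by rewrite /f lerBlDr addrC -[2 / a - 5]expRK ler_ln ?posrE ?expR_gt0 // root_bound_lo.
have fb : -5 <= f b.
  by rewrite /f lerBrDr addrC -[2 / b - 5]expRK ler_ln ?posrE ?expR_gt0 // root_bound_hi.
have fc : {within `[a, b], continuous f}.
  apply: continuous_in_subspaceT => x; rewrite inE /= in_itv /= => /andP[ax _].
  have x0 := lt_le_trans a0 ax.
  apply: cvgB; first exact: continuous_ln.
  by apply: (cvgM (cvg_cst _)); apply: cvgV; [rewrite gt_eqF|exact: cvg_id].
have [|r] := IVT (v := -5) ab fc.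
  by rewrite ge_min fa le_max fb orbT.
by rewrite in_itv /= => rab /eqP; rewrite subr_eq addrC => /eqP fr; exists r.
Qed.

Definition limit_value (R : realType) (r : R) : R :=
  r + 4 / (3 * r) * ((1 - r) `^ (3 / 2) - (1 - r) ^+ 2).

(** Since [r = (1 - s) * (1 + s)], the factor [1 - s] of [s ^+ 3 - s ^+ 4] cancels. *)
Lemma limit_valueE (R : realType) (r : R) (s := Num.sqrt (1 - r)) : 0 < r < 1 ->
  limit_value r = 1 - s ^+ 2 + 4 / 3 * s ^+ 3 / (1 + s).
Proof.
move=> /andP[r0 r1]; have r1' : 0 <= 1 - r by rewrite subr_ge0 ltW.
have sE : s ^+ 2 = 1 - r by rewrite sqr_sqrtr.
have s0 : 0 <= s by exact: sqrtr_ge0.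
have -> : limit_value r = r + 4 / (3 * r) * (s ^+ 3 - (1 - r) ^+ 2).
  rewrite /limit_value; congr (_ + _ * (_ - _)).
  by rewrite (mulrC 3) powRrM powR12_sqrt // powR_mulrn.
have -> : r = 1 - s ^+ 2 by rewrite sE; ring.
field; rewrite sE (_ : 1 - (1 - r) = r); last by ring.
by rewrite (gt_eqF r0) gt_eqF // ltr_wpDr.
Qed.

Lemma limit_value_bounds (R : realType) (r : R) :
  470 / 10 ^+ 3 + 926 / 10 ^+ 6 <= r <= 470 / 10 ^+ 3 + 928 / 10 ^+ 6 ->
  767 / 10 ^+ 3 + 974 / 10 ^+ 6 <= limit_value r < 767 / 10 ^+ 3 + 975 / 10 ^+ 6.
Proof.
move=> /andP[rlo rhi]; rewrite limit_valueE; last by lra.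
set s := Num.sqrt _; have s0 : 0 <= s by exact: sqrtr_ge0.
have sE : s ^+ 2 = 1 - r by rewrite sqr_sqrtr //; lra.
have sq_le (x y : R) : 0 <= x -> 0 <= y -> x ^+ 2 <= y ^+ 2 -> x <= y.
  by move=> x0 y0; rewrite ler_sqr.
have slo : 727 / 10 ^+ 3 + 373 / 10 ^+ 6 <= s.
  by apply: (sq_le _ _ _ s0); [lra|rewrite sE; lra].
have shi : s <= 727 / 10 ^+ 3 + 375 / 10 ^+ 6.
  by apply: (sq_le _ _ s0); [lra|rewrite sE; lra].
have s1 : 0 < 1 + s by lra.
rewrite (_ : 1 - s ^+ 2 + _ = (1 + s - s ^+ 2 + s ^+ 3 / 3) / (1 + s)); last first.
  by field; rewrite gt_eqF.
rewrite ler_pdivlMr // ltr_pdivrMr //.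
(* The cubic is expanded in the distance [t] from [s] to an end of its enclosing interval; these
   bounds on the powers of [t] leave linear goals. *)
have small (t : R) : 0 <= t -> t <= 2 / 10 ^+ 6 ->
    [/\ 0 <= t ^+ 2, t ^+ 2 <= 2 / 10 ^+ 6 * t & t ^+ 3 <= t ^+ 2].
  move=> t0 t1; split; first exact: sqr_ge0.
    by rewrite expr2 ler_wpM2r.
  by rewrite exprS ler_piMl ?sqr_ge0 //; lra.
move: slo shi {s0 sE s1}; move: s => s slo shi; apply/andP; split.
  have [] := small (727 / 10 ^+ 3 + 375 / 10 ^+ 6 - s); lra.
have [] := small (s - (727 / 10 ^+ 3 + 373 / 10 ^+ 6)); lra.
Qed.

(** * Asymptotics *)

(** [alpha n i] exceeds [2 / x - ln x] at [x = i / n] by at most [1 / i]. That function is 5 at [r]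
    and falls with slope at least 2 in size on [(0, 1]] ([cmp]). So no [i < r n] qualifies, and the
    last failing index [k] satisfies [k <= r n + 1 / r]. *)
Lemma rthresh_bounds (R : realType) (r : R) n : 0 < r < 1 -> ln r = 2 / r - 5 ->
  (0 < n)%N ->
  r * n%:R <= (rthresh R n)%:R <= r * n%:R + (1 + r^-1).
Proof.
move=> /andP[r0 r1] rE n0; have [/andP[m0 mn] ma mmin] := rthreshP R n0.
set m := rthresh R n in m0 mn ma mmin *.
have nP : 0 < n%:R :> R by rewrite ltr0n.
have alpha_near i : (0 < i <= n)%N ->
    2 / (i%:R / n%:R) - ln (i%:R / n%:R) <= alpha R n i
    <= 2 / (i%:R / n%:R) - ln (i%:R / n%:R) + i%:R^-1.
  move=> /andP[i0 iN]; have iP : 0 < i%:R :> R by rewrite ltr0n.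
  have := harmonic_from_ln R (_ : 0 < i <= n)%N; rewrite i0 iN => /(_ isT).
  have nV : 0 < n%:R^-1 :> R by rewrite invr_gt0.
  rewrite alphaE // ln_div ?posrE // invf_div mulrA => /andP[lo hi].
  by apply/andP; split; lra.
have cmp (x y : R) : 0 < x -> x <= y -> y <= 1 ->
    2 * (y - x) <= (2 / x - ln x) - (2 / y - ln y).
  move=> x0 xy y1; have y0 := lt_le_trans x0 xy.
  have lxy : ln x <= ln y by rewrite ler_ln ?posrE.
  have : 2 * (y - x) <= 2 / x - 2 / y.
    have -> : 2 / x - 2 / y = 2 * (y - x) / (x * y).
      by field; rewrite !gt_eqF.
    rewrite ler_pdivlMr ?mulr_gt0 // -[leRHS]mulr1 ler_wpM2l ?mulr_ge0 ?subr_ge0 //.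
    by rewrite mulr_ile1 // ?(ltW x0) ?(ltW y0) // (le_trans xy).
  lra.
have mP : 0 < m%:R :> R by rewrite ltr0n.
have mn1 : m%:R / n%:R <= 1 :> R by rewrite ler_pdivrMr // mul1r ler_nat.
apply/andP; split.
  rewrite -ler_pdivlMr // leNgt; apply/negP => mr.
  have := cmp _ _ (divr_gt0 mP nP) (ltW mr) (ltW r1).
  have /andP[lo _] := alpha_near m (introT andP (conj m0 mn)).
  lra.
case: m m0 mn ma mmin mP mn1 => // k _ kn _ mmin _ _; rewrite -natr1.
have rV : 0 < r^-1 by rewrite invr_gt0.
have rn0 : 0 < r * n%:R by rewrite mulr_gt0.
have [kr|rk] := leP k%:R (r * n%:R); first by lra.
have k0 : (0 < k)%N by rewrite -(ltr0n R) (lt_trans rn0).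
have kP : 0 < k%:R :> R by rewrite ltr0n.
have ka : 5 < alpha R n k.
  rewrite ltNge; apply/negP => /mmin; rewrite k0 (ltnW kn) => /(_ isT).
  by rewrite ltnn.
have /andP[_ hi] := alpha_near k (introT andP (conj k0 (ltnW kn))).
have rk' : r <= k%:R / n%:R by rewrite ler_pdivlMr // ltW.
have k1 : k%:R / n%:R <= 1 :> R by rewrite ler_pdivrMr // mul1r ler_nat ltnW.
have := cmp _ _ r0 rk' k1 => H.
have kV : k%:R^-1 <= r^-1 / n%:R.
  by rewrite -invfM lef_pV2 ?posrE // ltW.
have : k%:R / n%:R - r <= r^-1 / n%:R.
  have : 0 <= k%:R / n%:R - r by rewrite subr_ge0.
  lra.
move=> /(ler_wpM2r (ltW nP)); rewrite mulrBl !divfK ?gt_eqF //; lra.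
Qed.

(** Each product [u_i] equals [2 (n - i + 1) u_i - 2 (n - i) u_(i+1)], so the sum telescopes. The
    induction on [m] extends all products by one factor. *)
Lemma sum_prod_decline (R : realType) n m : (0 < m <= n)%N ->
  \sum_(1 <= i < m) \prod_(i <= j < m) decline_prob R n j =
  2 * n%:R * \prod_(1 <= j < m) decline_prob R n j - 2 * (n%:R - m%:R + 1).
Proof.
elim: m => // -[|m] IH /andP[_ mn].
  by rewrite !big_geq //; ring.
rewrite big_nat_recr //= big_nat1 [in RHS]big_nat_recr //=.
rewrite (eq_big_nat _ _ (F2 := fun i =>
    \prod_(i <= j < m.+1) decline_prob R n j * decline_prob R n m.+1)); last first.
  by move=> i /andP[_ im]; rewrite big_nat_recr //= ltnW.
rewrite -big_distrl /= IH; last exact: ltnW.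
rewrite /decline_prob natrB ?(ltnW mn) // -(@natr1 R m.+1).
have mnR : m.+1%:R + 1 <= n%:R :> R by rewrite natr1 ler_nat.
by field; rewrite gt_eqF //; lra.
Qed.

(** With [x = n - j], the square of the factor at [j] lies between [(x - 1) / x] and [x / (x + 1)],
    and these bounds telescope. *)
Lemma prod_decline_sqr (R : realType) n m : (0 < m <= n)%N ->
  1 - m%:R / n%:R <= (\prod_(1 <= j < m) decline_prob R n j) ^+ 2
  <= 1 - m%:R / n%:R + n%:R^-1.
Proof.
elim: m => // -[|m] IH /andP[_ mn].
  rewrite big_geq // expr1n mul1r subrK lexx andbT gerBl invr_ge0 //.
have /andP[lo hi] := IH (ltnW mn).
rewrite big_nat_recr //= exprMn /decline_prob natrB ?(ltnW mn) // -(@natr1 R m.+1).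
have mnR : m.+1%:R + 1 <= n%:R :> R by rewrite natr1 ler_nat.
have nP : 0 < n%:R :> R by rewrite ltr0n (leq_trans _ mn).
move: (\prod_(1 <= j < m.+1) _) lo hi mnR nP => u.
move: n%:R m.+1%:R => N M lo hi mnR nP.
have qP : 0 < (2 * (N - M) + 1) ^+ 2 by rewrite exprn_gt0 //; lra.
rewrite exprMn exprVn mulrA.
have lo' : N - M <= u ^+ 2 * N.
  by rewrite -ler_pdivrMr // mulrBl divff ?gt_eqF.
have hi' : u ^+ 2 * N <= N - M + 1.
  by rewrite -ler_pdivlMr // mulrDl mulrBl divff ?gt_eqF // mul1r.
apply/andP; split.
  rewrite ler_pdivlMr // -(ler_pM2r nP).
  have -> : (1 - (M + 1) / N) * (2 * (N - M) + 1) ^+ 2 * N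
     = (N - M - 1) * (2 * (N - M) + 1) ^+ 2 by field; rewrite gt_eqF.
  rewrite mulrAC.
  have q0 : 0 <= (2 * (N - M)) ^+ 2 by apply: sqr_ge0.
  apply: le_trans (ler_wpM2r q0 lo').
  nra.
rewrite ler_pdivrMr // -(ler_pM2r nP).
have -> : (1 - (M + 1) / N + N^-1) * (2 * (N - M) + 1) ^+ 2 * N
   = (N - M) * (2 * (N - M) + 1) ^+ 2 by field; rewrite gt_eqF.
rewrite mulrAC.
have q0 : 0 <= (2 * (N - M)) ^+ 2 by apply: sqr_ge0.
apply: le_trans (ler_wpM2r q0 hi') _.
nra.
Qed.

Lemma value1_ratio (R : realType) n m : (0 < m <= n)%N ->
  value1 R n m 1 = 1 / 3 *
    ((m%:R / n%:R + 2 * \prod_(1 <= j < m) decline_prob R n j - 2 - n%:R^-1)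
     * (3 - harmonic_from R n m) + 2 + m%:R / n%:R).
Proof.
move=> mn; have nP : 0 < n%:R :> R by rewrite ltr0n; case/andP: mn; lia.
rewrite value1_1 // sum_prod_decline //; field.
by rewrite gt_eqF.
Qed.

Lemma cvg_invn (R : realType) : (n%:R^-1 : R) @[n --> \oo] --> 0.
Proof.
apply/gtr0_cvgV0; last exact: cvgr_idn.
by near=> n; rewrite ltr0n; near: n; exact: nbhs_infty_gt.
Unshelve. all: by end_near. Qed.

Section threshold_limits.
Variables (R : realType) (r : R).
Hypotheses (r01 : 0 < r < 1) (rE : ln r = 2 / r - 5).
Let m n := rthresh R n.

Lemma cvg_rthresh : (m n)%:R / n%:R @[n --> \oo] --> r.
Proof.
apply: (@squeeze_cvgr _ _ _ _ (cst r) (fun n => r + (1 + r^-1) * n%:R^-1)).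
- near=> n; have n0 : (0 < n)%N by near: n; exact: nbhs_infty_gt.
  have nP : 0 < n%:R :> R by rewrite ltr0n.
  have /andP[lo hi] := rthresh_bounds r01 rE n0.
  rewrite /= ler_pdivlMr // lo ler_pdivrMr //.
  by rewrite mulrDl mulfVK ?gt_eqF.
- exact: cvg_cst.
- rewrite -[X in _ --> X]addr0; apply: cvgD; first exact: cvg_cst.
  by rewrite -(mulr0 (1 + r^-1)); apply: (cvgM (cvg_cst _)); exact: cvg_invn.
Unshelve. all: by end_near. Qed.

Lemma cvg_harmonic_rthresh : harmonic_from R n (m n) @[n --> \oo] --> - ln r.
Proof.
have /andP[r0 r1] := r01.
have L : - ln ((m n)%:R / n%:R) @[n --> \oo] --> - ln r.
  by apply: cvgN; apply: (continuous_cvg _ (continuous_ln r0)); exact: cvg_rthresh.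
have U : - ln ((m n)%:R / n%:R) + r^-1 * n%:R^-1 @[n --> \oo] --> - ln r.
  rewrite -[X in _ --> X]addr0; apply: cvgD => //.
  by rewrite -(mulr0 r^-1); apply: (cvgM (cvg_cst _)); exact: cvg_invn.
apply: (squeeze_cvgr _ L U).
near=> n; have n0 : (0 < n)%N by near: n; exact: nbhs_infty_gt.
have nP : 0 < n%:R :> R by rewrite ltr0n.
have [mn _ _] := rthreshP R n0; have /andP[m0 _] := mn.
have mP : 0 < (m n)%:R :> R by rewrite ltr0n.
have /andP[lo hi] := harmonic_from_ln R mn.
have /andP[rm _] := rthresh_bounds r01 rE n0.
have mV : (m n)%:R^-1 <= r^-1 / n%:R.
  by rewrite -invfM lef_pV2 ?posrE // mulr_gt0.
have nV : 0 < n%:R^-1 :> R by rewrite invr_gt0.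
rewrite ln_div ?posrE // opprB lo /=.
by apply: (le_trans hi); rewrite -/(m n); lra.
Unshelve. all: by end_near. Qed.

Lemma cvg_prod_decline :
  \prod_(1 <= j < m n) decline_prob R n j @[n --> \oo] --> Num.sqrt (1 - r).
Proof.
have L : 1 - (m n)%:R / n%:R @[n --> \oo] --> 1 - r.
  by apply: cvgB; [exact: cvg_cst|exact: cvg_rthresh].
have U : 1 - (m n)%:R / n%:R + n%:R^-1 @[n --> \oo] --> 1 - r.
  by rewrite -[X in _ --> X]addr0; apply: cvgD => //; exact: cvg_invn.
rewrite (_ : (fun n => _) = (fun n =>
    Num.sqrt ((\prod_(1 <= j < m n) decline_prob R n j) ^+ 2))).
  apply: (continuous_cvg _ (@sqrt_continuous R _)).
  apply: (squeeze_cvgr _ L U).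
  near=> n; have n0 : (0 < n)%N by near: n; exact: nbhs_infty_gt.
  by have [mn _ _] := rthreshP R n0; exact: prod_decline_sqr.
apply/funext => n; rewrite sqrtr_sqr ger0_norm // prodr_ge0 // => j _.
by rewrite divr_ge0 // addr_ge0 ?mulr_ge0.
Unshelve. all: by end_near. Qed.

Lemma cvg_value1 : value1 R n (m n) 1 @[n --> \oo] --> limit_value r.
Proof.
have /andP[r0 r1] := r01.
set s := Num.sqrt (1 - r).
have sE : s ^+ 2 = 1 - r by rewrite sqr_sqrtr // subr_ge0 ltW.
(* This is the shape in which [value1_ratio] converges; the equation for [r] gives
   [3 + ln r = 2 / r - 2]. *)
have -> : limit_value r =
    1 / 3 * ((r + 2 * s - 2 - 0) * (3 - - ln r) + 2 + r).
  rewrite limit_valueE // -/s rE.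
  have rs : r = 1 - s ^+ 2 by rewrite sE; ring.
  have s0 : 0 <= s by exact: sqrtr_ge0.
  rewrite rs; field.
  rewrite -rs (gt_eqF r0) gt_eqF // ltr_wpDr //.
apply: (@cvg_trans _ ((fun n => 1 / 3 *
    (((m n)%:R / n%:R + 2 * \prod_(1 <= j < m n) decline_prob R n j - 2 - n%:R^-1)
     * (3 - harmonic_from R n (m n)) + 2 + (m n)%:R / n%:R)) @ \oo)).
  apply: near_eq_cvg; near=> n.
  have n0 : (0 < n)%N by near: n; exact: nbhs_infty_gt.
  by have [mn _ _] := rthreshP R n0; rewrite value1_ratio.
apply: (cvgM (cvg_cst _)); apply: cvgD; last exact: cvg_rthresh.
apply: cvgD; last exact: cvg_cst.
apply: cvgM.
  apply: cvgB; last exact: cvg_invn.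
  apply: cvgB; last exact: cvg_cst.
  apply: cvgD; first exact: cvg_rthresh.
  by apply: (cvgM (cvg_cst _)); exact: cvg_prod_decline.
by apply: cvgB; [exact: cvg_cst|exact: cvg_harmonic_rthresh].
Unshelve. all: by end_near. Qed.

End threshold_limits.

(** * Exact optimal value and its limit *)

Theorem theorem2p3 (R : realType) (d : nat -> measure_display)
    (T : forall n : nat, measurableType (d n))
    (P : forall n : nat, probability (T n) R)
    (rk : forall n : nat, 'I_n.*2 -> {RV (P n) >-> nat})
    (Huniform : forall n : nat, (1 <= n)%N -> uniform_order (rk n)) :
  (forall n : nat, (1 <= n)%N ->
     max_success (rk n)
     = (1 / (3 * n%:R)
        * ((1 - (rthresh R n)%:R
            + \sum_(1 <= i < rthresh R n) \prod_(i <= j < rthresh R n)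
                (2 * (n - j)%:R / (2 * (n - j)%:R + 1)))
           * (3 - \sum_(rthresh R n <= l < n) l%:R^-1)
           + 2 * n%:R + (rthresh R n)%:R))%:E)
  /\
  (exists r : R,
     [/\ (rthresh R n)%:R / n%:R @[n --> \oo] --> r,
         0 < r,
         r * expR (- 2 / r) = expR (- 5),
         max_success (rk n) @[n --> \oo] -->
           (r + 4 / (3 * r) * ((1 - r) `^ (3 / 2) - (1 - r) ^+ 2))%:E
       & 767 / 10 ^+ 3 + 974 / 10 ^+ 6
         <= r + 4 / (3 * r) * ((1 - r) `^ (3 / 2) - (1 - r) ^+ 2)
         < 767 / 10 ^+ 3 + 975 / 10 ^+ 6]).
Proof.
split=> [n n1|].
  rewrite (@max_success_formula _ _ _ _ n (rk n) n1 (Huniform _ n1)) value1_1 //.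
  by have [] := rthreshP R n1.
have [r rb rE] := threshold_root R.
have r01 : 0 < r < 1 by lra.
have /andP[r0 _] := r01.
exists r; split=> //.
- exact: cvg_rthresh.
- rewrite -[X in X * _](lnK (x := r)) ?posrE // rE -expRD; congr expR; ring.
- have eqv : \forall n \near \oo,
      max_success (rk n) = (value1 R n (rthresh R n) 1)%:E.
    near=> n; have n0 : (0 < n)%N by near: n; exact: nbhs_infty_gt.
    exact: max_success_formula n0 (Huniform _ n0).
  apply: cvg_EFin; first by near=> n; rewrite (near eqv n).
  apply: cvg_trans (cvg_value1 r01 rE); apply: near_eq_cvg.
  by near=> n; rewrite /= (near eqv n).
- exact: limit_value_bounds rb.
Unshelve. all: by end_near. Qed.
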